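(* Let $m\ge2$, $k=2m$, and let $X_k$ be the $(2,k,\infty)$ Hecke surface. Then $$\frac{\big|\{\gamma\subset X_k \text{ a reciprocal geodesic based at the order } k \text{ cone point}: |\gamma|=2t\}\big|}{\big|\{\gamma\subset X_k \text{ a reciprocal geodesic based at the order } 2 \text{ cone point}: |\gamma|=2t\}\big|}\xrightarrow{t\to\infty}\frac{e_{2m}}{d_{2m}} .$$ In particular, $$\frac{\big|\{\gamma \text{ any reciprocal geodesic in } X_k: |\gamma|=2t\}\big|}{\beta_{2m}^{t}}\xrightarrow{t\to\infty}\frac{d_{2m}+e_{2m}}{2},$$ where $\beta_{2m}$ is the unique positive root of $x^{m+1}-2x^{m-1}-2x^{m-2}-\dots-2x-1$, and $d_{2m},e_{2m}$ are the positive constants defined in the context.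
   Context: Let $k=2m$ with $m\ge 2$ and $G=\mathbb{Z}_2*\mathbb{Z}_k$, with $a$ the generator of $\mathbb{Z}_2$ and $b$ the generator of $\mathbb{Z}_k$. The Hecke group $\Gamma_k\subset \mathrm{PSL}(2,\mathbb{R})$ is the image of $G$ under the discrete faithful representation $a\mapsto A=\begin{pmatrix}0&-1\\1&0\end{pmatrix}$, $b\mapsto B=\begin{pmatrix}0&-1\\1&2\cos(\pi/k)\end{pmatrix}$, and $X_k=\mathbb{H}/\Gamma_k$ is the $(2,k,\infty)$ Hecke surface. A reciprocal geodesic based at the order $2$ (respectively order $k=2m$) cone point is the conjugacy class in $G\cong\Gamma_k$ of a product of two distinct involutions, both conjugate to $a$ (respectively both conjugate to $b^m$). A reciprocal geodesic in $X_k$ is one based at the order $2$ cone point or at the order $k$ cone point (possibly both). Geodesics are counted as conjugacy classes. The word length $|g|$ of $g\in G$ is with respect to $\{a,b,b^{-1}\}$, and the length $|\gamma|$ of the reciprocal geodesic corresponding to $[g]$ is $\min\{|h|: h\in[g]\}$. Constants. Let $E_k=\{l\in\mathbb{Z}\setminus\{0\}: -m+1\le l\le m\}$. A $(bb)$-word is $b^{x_0}ab^{x_1}\cdots ab^{x_{n-1}}$ with $n\ge1$, $x_i\in E_k$; an $(aa)$-word is $ab^{x_0}ab^{x_1}\cdots ab^{x_{n-1}}a$ with $n\ge0$, $x_i\in E_k$ (for $n=0$ it is $a$). Write $[x,y]=xyx^{-1}y^{-1}$. Let $\mathcal{N}_{2t}$ be the set of elements $[a,h]$ of word length $2t$ with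 $h$ a $(bb)$-word, and $\mathcal{N}'_{2t}$ the set of elements $[b^m,h]$ of word length $2t$ with $h$ an $(aa)$-word. Both sequences $|\mathcal{N}_{2t}|$ ($t\ge2$) and $|\mathcal{N}'_{2t}|$ ($t\ge3$) satisfy the linear recurrence with characteristic polynomial $x^{m+1}-2x^{m-1}-\dots-2x-1$, which has $m+1$ distinct complex roots, exactly one of which, $\beta_{2m}$, is positive. Hence each sequence is uniquely a linear combination of the $t$-th powers of these roots; $d_{2m}$ (respectively $e_{2m}$) is the coefficient of $\beta_{2m}^t$ in the expression for $|\mathcal{N}_{2t}|$ (respectively $|\mathcal{N}'_{2t}|$). *)

(* Defs.v *)
From HB Require Import structures.
From mathcomp Require Import all_boot all_order all_algebra all_fingroup.
From mathcomp Require Import generic_quotient finmap.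
From mathcomp Require Import all_classical all_reals all_analysis.
From mathcomp Require Import complex.

Set Implicit Arguments.
Unset Strict Implicit.
Unset Printing Implicit Defensive.

Import Order.TTheory GRing.Theory Num.Theory.
Import numFieldNormedType.Exports.

Local Open Scope classical_set_scope.
Local Open Scope quotient_scope.

(* The free product H * K of two groups: words over the disjoint union of H
   and K, modulo the congruence generated by multiplication inside each
   factor and erasure of the two identities. *)
Section FreeProduct.
Variables H K : groupType.

Inductive fp_eq : seq (H + K) -> seq (H + K) -> Prop :=
| fp_refl u : fp_eq u u
| fp_sym u v : fp_eq u v -> fp_eq v u
| fp_trans u v w : fp_eq u v -> fp_eq v w -> fp_eq u w
| fp_cat u u' v v' : fp_eq u u' -> fp_eq v v' -> fp_eq (u ++ v) (u' ++ v')
| fp_onel : fp_eq [:: inl 1%g] [::]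
| fp_oner : fp_eq [:: inr 1%g] [::]
| fp_mull (x y : H) : fp_eq [:: inl x; inl y] [:: inl (x * y)%g]
| fp_mulr (x y : K) : fp_eq [:: inr x; inr y] [:: inr (x * y)%g].

Definition fp_eqb (u v : seq (H + K)) : bool := `[< fp_eq u v >].

Fact fp_eqb_refl : reflexive fp_eqb.
Proof. by move=> u; apply/asboolP; exact: fp_refl. Qed.

Fact fp_eqb_sym : symmetric fp_eqb.
Proof. by move=> u v; apply/asboolP/asboolP => /fp_sym. Qed.

Fact fp_eqb_trans : transitive fp_eqb.
Proof.
move=> v u w /asboolP uv /asboolP vw; apply/asboolP; exact: fp_trans uv vw.
Qed.

Canonical fp_equiv := EquivRel fp_eqb fp_eqb_refl fp_eqb_sym fp_eqb_trans.

Definition freeprod := {eq_quot fp_equiv}.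
HB.instance Definition _ := Choice.copy freeprod {eq_quot fp_equiv}.
HB.instance Definition _ := EqQuotient.on freeprod.

Lemma fp_piP (u v : seq (H + K)) :
  (\pi_freeprod u = \pi_freeprod v) <-> fp_eq u v.
Proof.
split; first by move/eqmodP/asboolP.
by move=> uv; apply/eqmodP/asboolP.
Qed.

Lemma fp_repr_eq (u : seq (H + K)) : fp_eq (repr (\pi_freeprod u)) u.
Proof. by apply/fp_piP; rewrite reprK. Qed.

Definition fp_mul (x y : freeprod) : freeprod := \pi_freeprod (repr x ++ repr y).
Definition fp_one : freeprod := \pi_freeprod [::].
Definition letter_inv (l : H + K) : H + K :=
  match l with inl x => inl (x^-1)%g | inr y => inr (y^-1)%g end.
Definition fp_inv (x : freeprod) : freeprod :=
  \pi_freeprod (rev (map letter_inv (repr x))).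

Lemma fp_mul_pi (u v : seq (H + K)) : fp_mul (\pi_freeprod u) (\pi_freeprod v) = \pi_freeprod (u ++ v).
Proof. by apply/fp_piP; apply: fp_cat; exact: fp_repr_eq. Qed.

Fact fp_mulA : associative fp_mul.
Proof.
elim/quotW=> u; elim/quotW=> v; elim/quotW=> w.
by rewrite (fp_mul_pi v w) (fp_mul_pi u v) (fp_mul_pi u) (fp_mul_pi (_ ++ _)) catA.
Qed.

Fact fp_mul1 : left_id fp_one fp_mul.
Proof. by elim/quotW=> u; rewrite fp_mul_pi. Qed.

Fact fp_mulr1 : right_id fp_one fp_mul.
Proof. by elim/quotW=> u; rewrite fp_mul_pi cats0. Qed.

Lemma fp_letterV (l : H + K) : fp_eq [:: letter_inv l; l] [::].
Proof.
case: l => x /=.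
- by apply: (fp_trans (fp_mull _ _)); rewrite mulVg; exact: fp_onel.
- by apply: (fp_trans (fp_mulr _ _)); rewrite mulVg; exact: fp_oner.
Qed.

Lemma fp_wordV (u : seq (H + K)) : fp_eq (rev (map letter_inv u) ++ u) [::].
Proof.
elim: u => [|l u IHu] /=; first exact: fp_refl.
rewrite rev_cons cat_rcons; apply: fp_trans IHu.
apply: fp_cat; first exact: fp_refl.
rewrite -[_ :: _]/([:: letter_inv l; l] ++ u) -{2}[u]/([::] ++ u).
by apply: fp_cat; [exact: fp_letterV | exact: fp_refl].
Qed.

Lemma letter_invK : involutive letter_inv.
Proof. by case=> x /=; rewrite invgK. Qed.

Fact fp_mulVg : left_inverse fp_one fp_inv fp_mul.
Proof.
move=> x; rewrite -{2}(reprK x) /fp_inv fp_mul_pi.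
by apply/fp_piP; exact: fp_wordV.
Qed.

Fact fp_mulgV : right_inverse fp_one fp_inv fp_mul.
Proof.
move=> x; rewrite -{1}(reprK x) /fp_inv fp_mul_pi; apply/fp_piP.
have := fp_wordV (rev (map letter_inv (repr x))).
by rewrite map_rev revK -map_comp map_id_in // => l _ /=; rewrite letter_invK.
Qed.

HB.instance Definition _ := isGroup.Build freeprod
  fp_mulA fp_mul1 fp_mulr1 fp_mulVg fp_mulgV.

Definition fp_inl (x : H) : freeprod := \pi_freeprod [:: inl x].
Definition fp_inr (y : K) : freeprod := \pi_freeprod [:: inr y].

End FreeProduct.

(* The least element of A, for A nonempty. *)
Definition min_nat (A : set nat) : nat :=
  xget 0 [set n | A n /\ forall p, A p -> n <= p].

Section GroupNotions.
Variable gT : groupType.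

Definition word_length (S : seq gT) (g : gT) : nat :=
  min_nat [set n | exists s : seq gT,
    [/\ size s = n, {subset s <= S} & (\prod_(x <- s) x)%g = g]].

Definition conj_class (g : gT) : set gT := [set (g ^ x)%g | x in setT].

Definition expgz (g : gT) (z : int) : gT :=
  match z with Posz n => (g ^+ n)%g | Negz n => (g ^- n.+1)%g end.

(* The convention is [x, y] = x y x^-1 y^-1, whereas the library's [~ x, y]
   is x^-1 y^-1 x y. *)
Definition commutator (x y : gT) : gT := (x * y * x^-1 * y^-1)%g.

End GroupNotions.

(* The factors are the additive groups 'Z_2 and 'Z_(2 * m), seen as groups
   through the instances of zmodp; 1%R is their standard generator. *)
Definition heckeG (m : nat) : groupType := freeprod 'Z_2 'Z_(2 * m).

Section Hecke.
Variable m : nat.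
Local Notation G := (heckeG m).

Definition genA : G := fp_inl 'Z_(2 * m) (1%R : 'Z_2).
Definition genB : G := fp_inr 'Z_2 (1%R : 'Z_(2 * m)).

Definition hlength : G -> nat := word_length [:: genA; genB; (genB^-1)%g].

(* Reciprocal geodesics of the Hecke surface, as conjugacy classes in
   G = Z_2 * Z_k (isomorphic to the Hecke group), based at the cone point
   fixed by the involution i. *)
Definition reciprocal_at (i : G) : set (set G) :=
  [set C | exists x y : G, [/\ conj_class i x, conj_class i y, x != y
                             & C = conj_class (x * y)%g]].

Definition reciprocal_order2 : set (set G) := reciprocal_at genA.
Definition reciprocal_orderk : set (set G) := reciprocal_at (genB ^+ m)%g.
Definition reciprocal : set (set G) :=
  reciprocal_order2 `|` reciprocal_orderk.

Definition geod_length (C : set G) : nat := min_nat (hlength @` C).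

Definition of_length (A : set (set G)) (n : nat) : set (set G) :=
  [set C | A C /\ geod_length C = n].

Definition Ek : set int :=
  [set l | [/\ l != 0%R, (- m%:Z + 1 <= l)%R & (l <= m%:Z)%R]].

Definition ab_word (s : seq int) : G :=
  (\prod_(x <- s) (genA * expgz genB x))%g.

Definition bb_word (h : G) : Prop :=
  exists (x0 : int) (s : seq int),
    (forall x, x \in x0 :: s -> Ek x) /\ h = (expgz genB x0 * ab_word s)%g.

Definition aa_word (h : G) : Prop :=
  exists s : seq int,
    (forall x, x \in s -> Ek x) /\ h = (ab_word s * genA)%g.

Definition Naa (t : nat) : set G :=
  [set g | hlength g = 2 * t /\
           exists2 h, bb_word h & g = commutator genA h].

Definition Nbb (t : nat) : set G :=
  [set g | hlength g = 2 * t /\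
           exists2 h, aa_word h & g = commutator (genB ^+ m)%g h].

End Hecke.

Arguments reciprocal_order2 : clear implicits.
Arguments reciprocal_orderk : clear implicits.
Arguments reciprocal : clear implicits.
Arguments Naa : clear implicits.
Arguments Nbb : clear implicits.

(* fset_set is meaningful on finite sets only; finite_hlength and
   finite_of_length below show that this is the case where cardset is used
   (lengths 2 * t with 0 < t). *)
Definition cardset (T : choiceType) (A : set T) : nat := #|` fset_set A|%fset.

Lemma min_nat_mem (A : set nat) n : min_nat A = n -> 0 < n -> A n.
Proof.
rewrite /min_nat; case: xgetP => [p -> [Ap _] <- //|_ <-]; by rewrite ltnn.
Qed.

Lemma finite_words (T : eqType) (S : seq T) n :
  finite_set [set s : seq T | size s = n /\ {subset s <= S}].
Proof.
elim: n => [|n IHn].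
  apply: (@sub_finite_set _ _ [set [::]]); last exact: finite_set1.
  by move=> s [/size0nil].
apply: (@sub_finite_set _ _
  ((fun p => p.1 :: p.2) @` ([set` S] `*` [set s | size s = n /\ {subset s <= S}]))).
  move=> [|x s] [] //= [sn] sub; exists (x, s) => //=; split => /=.
    by apply: sub; rewrite mem_head.
  by split=> // y ys; apply: sub; rewrite inE ys orbT.
apply: finite_image; apply: finite_setX => //; exact: finite_seq.
Qed.

Lemma finite_word_length (gT : groupType) (S : seq gT) n :
  0 < n -> finite_set [set g | word_length S g = n].
Proof.
move=> n0; apply: (@sub_finite_set _ _ ((fun s => (\prod_(x <- s) x)%g) @`
   [set s : seq gT | size s = n /\ {subset s <= S}])).
  by move=> g /= /min_nat_mem/(_ n0) [s [sn sS <-]]; exists s.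
by apply: finite_image; exact: finite_words.
Qed.

Lemma finite_hlength m n :
  0 < n -> finite_set [set g : heckeG m | hlength g = n].
Proof. exact: finite_word_length. Qed.

Lemma conj_classE (gT : groupType) (g h : gT) :
  conj_class g h -> conj_class g = conj_class h.
Proof.
move=> [x _ <-]; apply/seteqP; split=> [_ [y _ <-]|_ [y _ <-]].
  by exists (x^-1 * y)%g => //; rewrite -conjgM mulVKg.
by exists (x * y)%g => //; rewrite conjgM.
Qed.

Lemma finite_of_length m n :
  0 < n -> finite_set (of_length (reciprocal m) n).
Proof.
move=> n0; apply: (@sub_finite_set _ _
    (@conj_class _ @` [set g : heckeG m | hlength g = n])).
  move=> C [recC] /min_nat_mem/(_ n0) [h Ch hn]; exists h => //.
  by case: recC => -[x [y [_ _ _ eC]]]; rewrite eC; symmetry;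
    apply: conj_classE; rewrite -eC.
by apply: finite_image; exact: finite_hlength.
Qed.

Section Constants.
Local Open Scope ring_scope.
Local Open Scope complex_scope.

Definition char_poly2m (R : nzRingType) (m : nat) : {poly R} :=
  'X^(m.+1) - \sum_(1 <= i < m) 2%:R *: 'X^i - 1.

Variables (R : realType) (m : nat).

Definition beta : R := xget 0 [set x : R | 0 < x /\ root (char_poly2m R m) x].

(* The coefficient of beta ^+ t in the expression of u t, for t >= t0, as a
   linear combination of the t-th powers of all the complex roots of
   char_poly2m. *)
Definition beta_coef (t0 : nat) (u : nat -> nat) : R :=
  xget 0 [set d : R | exists (rs : seq R[i]) (c : R[i] -> R[i]),
    [/\ uniq rs,
        forall z, (z \in rs) = root (char_poly2m R[i] m) z,
        forall t, (t0 <= t)%N -> (u t)%:R = \sum_(z <- rs) c z * z ^+ t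
      & c beta%:C = d%:C]].

Definition d_const : R := beta_coef 2 (fun t => cardset (Naa m t)).
Definition e_const : R := beta_coef 3 (fun t => cardset (Nbb m t)).

End Constants.

(* Main.v *)
Require Import Defs.
From mathcomp Require Import all_boot all_order all_algebra.
From mathcomp Require Import generic_quotient finmap separable complex.
From mathcomp Require Import all_classical all_reals all_analysis.
From mathcomp Require Import ring lra zify.

(* Write P(s) for the product of the a b^y over the entries y of a list s of
   nonzero residues mod 2m. Up to conjugacy, a product of two distinct
   conjugates of a is P(w ++ w'), where w' is the reversed and negated w, and a
   product of two distinct conjugates of b^m is P(w ++ m :: w' ++ [m]). The
   lists w of weight sum (1 + |y|) = t, respectively t - m - 1, also
   parametrize the sets N_{2t} and N'_{2t}.
   Two elements P(s), P(s') are conjugate only if s' is a cyclic shift of s.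
   The reflections of the cyclic word that preserve it up to sign then show
   that at most two lists give the same class, that w and w' always do, and
   that a class of both types has w = w'. The lists with w = w' are
   determined by a half of them, so there are O(beta^(t/2)) of them, and the
   numbers of classes are |N_{2t}|/2 and |N'_{2t}|/2 up to a negligible error.
   Finally (x - 1) p(x) = (x + 1) (x^(m+1) - 2 x^m + 1) for the characteristic
   polynomial p, whence its roots z are simple and the sequence with initial
   values 0, ..., 0, 1 is the sum of the z^i / p'(z); all roots but beta have
   modulus less than beta. *)

Set Implicit Arguments.
Unset Strict Implicit.
Unset Printing Implicit Defensive.

Import Order.TTheory GRing.Theory Num.Theory.
Import numFieldNormedType.Exports.

Local Open Scope classical_set_scope.

(** * Normal forms in the free product *)

Section NormalForm.
Local Open Scope quotient_scope.
Local Open Scope group_scope.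
Variable m : nat.
Local Notation K := 'Z_(2 * m).
Local Notation G := (heckeG m).
Local Notation a := (genA m).

Definition powB (y : K) : G := fp_inr 'Z_2 y.

Definition nonzeros (s : seq K) : bool := all (fun y => y != 0%R) s.

Definition prodAB (s : seq K) : G := \prod_(y <- s) (a * powB y).

Lemma mulg_pi u v : \pi_G u * \pi_G v = \pi_G (u ++ v).
Proof. exact: fp_mul_pi. Qed.

Lemma powB0 : powB 0%R = 1.
Proof. by apply/fp_piP; exact: (fp_oner 'Z_2 K). Qed.

Lemma powBD y z : powB (y + z)%R = powB y * powB z.
Proof.
rewrite mulg_pi; apply/fp_piP/fp_sym; exact: (fp_mulr 'Z_2 y z).
Qed.

Lemma powBN y : powB (- y)%R = (powB y)^-1.
Proof. by apply: (mulIg (powB y)); rewrite mulVg -powBD addNr powB0. Qed.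

Lemma powBMn n : powB n%:R%R = genB m ^+ n.
Proof.
elim: n => [|n IHn]; first by rewrite powB0.
by rewrite expgSr -IHn -natr1 powBD.
Qed.

Lemma genA2 : a * a = 1.
Proof.
rewrite mulg_pi; apply/fp_piP.
apply: (fp_trans (fp_mull K (1%R : 'Z_2) 1%R)).
have -> : ((1%R : 'Z_2) * 1%R)%g = 1%g by apply/val_inj.
exact: fp_onel.
Qed.

Lemma genAV : a^-1 = a.
Proof. by apply: (mulIg a); rewrite mulVg genA2. Qed.

Lemma genAK : involutive ( *%g a).
Proof. by move=> g; rewrite mulgA genA2 mul1g. Qed.

Lemma prodAB_nil : prodAB [::] = 1.
Proof. by rewrite /prodAB big_nil. Qed.

Lemma prodAB_cons y s : prodAB (y :: s) = a * powB y * prodAB s.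
Proof. by rewrite /prodAB big_cons. Qed.

Lemma prodAB1 y : prodAB [:: y] = a * powB y.
Proof. by rewrite prodAB_cons prodAB_nil mulg1. Qed.

Lemma prodAB_cat s1 s2 : prodAB (s1 ++ s2) = prodAB s1 * prodAB s2.
Proof. by rewrite /prodAB big_cat. Qed.

(* The list x0 :: s encodes b^x0 a b^x1 ... a b^xn; it is reduced when all its
   entries other than the first and the last are nonzero. *)
Fixpoint reduced_tail (s : seq K) : bool :=
  if s is y :: s' then ((y != 0%R) || (s' == [::])) && reduced_tail s' else true.
Definition reduced (L : seq K) : bool :=
  if L is _ :: s then reduced_tail s else false.

(** Left multiplication by a on encoded words: a leading exponent 0 followed by a letter a lets the
    two a's cancel, otherwise a new leading exponent 0 appears. The list [[:: 0]] encodes 1 and has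
    no a to cancel. *)
Definition actA (L : seq K) : seq K :=
  match L with
  | [::] => [::]
  | y :: s => if (y == 0%R) && (s != [::]) then s else 0%R :: y :: s
  end.
Definition actB (y : K) (L : seq K) : seq K :=
  if L is x :: s then (y + x)%R :: s else [::].
Definition act (l : 'Z_2 + K) (L : seq K) : seq K :=
  match l with
  | inl x => if x == 0%R then L else actA L
  | inr y => actB y L
  end.

Lemma reduced_actA L : reduced L -> reduced (actA L).
Proof.
case: L => [|y s] //=; case: eqP => [->|/eqP ny] /=.
  by case: s => [|z s] //= /andP[].
by rewrite ny.
Qed.

Lemma reduced_actB y L : reduced L -> reduced (actB y L).
Proof. by case: L. Qed.

Lemma reduced_act l L : reduced L -> reduced (act l L).
Proof.
case: l => [x|y] rL /=; last exact: reduced_actB.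
by case: ifP => // _; exact: reduced_actA.
Qed.

Lemma actAK L : reduced L -> actA (actA L) = L.
Proof.
case: L => [|y s] //=; case: eqP => [->|/eqP ny] //=.
case: s => [|z s] //=; case: (z =P 0%R) => [->|] //=.
by case: s.
Qed.

Definition actw (u : seq ('Z_2 + K)) (L : seq K) : seq K := foldr act L u.

Lemma reduced_actw u L : reduced L -> reduced (actw u L).
Proof. by move=> rL; elim: u => //= l u; exact: reduced_act. Qed.

(** Van der Waerden's argument: letters act on reduced lists and each defining relation acts
    trivially, so the action of a word depends only on its class. Reducedness matters for the
    relation a a = 1, through [actAK]. *)
Lemma actw_eq u v : fp_eq u v -> forall L, reduced L -> actw u L = actw v L.
Proof.
elim=> {u v}.
- by [].
- by move=> u v _ IH L rL; rewrite IH.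
- by move=> u v w _ IH1 _ IH2 L rL; rewrite IH1 // IH2.
- move=> u u' v v' _ IH1 _ IH2 L rL; rewrite /actw !foldr_cat.
  by rewrite -!/(actw _ _) IH2 // IH1 // reduced_actw.
- by [].
- by move=> [|x L] //= _; rewrite [X in X :: _]add0r.
- move=> x y L rL /=.
  case: x => [[|[|x]] hx] //; case: y => [[|[|y]] hy] //=.
  by rewrite actAK.
- by move=> x y [|z L] //= _; rewrite addrA.
Qed.

Definition nform (g : G) : seq K := actw (repr g) [:: 0%R].

Lemma nform_pi u : nform (\pi_G u) = actw u [:: 0%R].
Proof. by rewrite /nform (actw_eq (fp_repr_eq u)). Qed.

Lemma reduced_nform g : reduced (nform g).
Proof. exact: reduced_actw. Qed.

Lemma nform1 : nform 1 = [:: 0%R].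
Proof. by rewrite nform_pi. Qed.

Lemma nform_word u g : nform (\pi_G u * g) = actw u (nform g).
Proof.
elim/quotW: g => v.
by rewrite mulg_pi !nform_pi /actw foldr_cat.
Qed.

Lemma nformA g : nform (a * g) = actA (nform g).
Proof. by rewrite nform_word. Qed.

Lemma nformB y g : nform (powB y * g) = actB y (nform g).
Proof. by rewrite nform_word. Qed.

Definition ev (L : seq K) : G :=
  if L is x :: s then powB x * prodAB s else 1.

Lemma ev_actA L : L != [::] -> ev (actA L) = a * ev L.
Proof.
case: L => [|y s] //= _; case: eqP => [->|_] /=.
  case: s => [|z s] /=; rewrite powB0 !mul1g ?prodAB_cons.
    by rewrite powB0 mulg1.
  by rewrite !mulgA genA2 mul1g.
by rewrite powB0 mul1g prodAB_cons mulgA.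
Qed.

Lemma ev_actB y L : L != [::] -> ev (actB y L) = powB y * ev L.
Proof. by case: L => [|x s] //= _; rewrite powBD mulgA. Qed.

(** [ev] turns the action on lists into left multiplication, so induction on a word representing g
    suffices. Together with [nform_ev] this makes [nform] a bijection from the group onto the
    reduced lists. *)
Lemma ev_nform g : ev (nform g) = g.
Proof.
elim/quotW: g => u; rewrite nform_pi.
elim: u => [|l u IHu] /=; first by rewrite powB0 mul1g prodAB_nil.
have nu : actw u [:: 0%R] != [::].
  by have := @reduced_actw u [:: 0%R] isT; case: (actw _ _).
have -> : \pi_G (l :: u) = \pi_G [:: l] * \pi_G u by rewrite mulg_pi.
case: l => [x|y] /=; last by rewrite ev_actB // IHu.
case: eqP => [->|/eqP nx].
  rewrite IHu -[LHS]mul1g; congr (_ * _).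
  by apply/fp_piP/fp_sym; exact: (fp_onel 'Z_2 K).
rewrite ev_actA // IHu; congr (_ * _).
suff -> : x = 1%R by [].
by apply/val_inj; case: x nx => [[|[|x]] hx].
Qed.

Lemma nform_prodAB s : reduced_tail s -> nform (prodAB s) = 0%R :: s.
Proof.
elim: s => [|y s IHs] /=; first by rewrite prodAB_nil nform1.
move=> /andP[ny rs]; rewrite prodAB_cons -mulgA nformA nformB IHs //= addr0.
by case: (y =P 0%R) ny => //= _ ->.
Qed.

Lemma nform_ev L : reduced L -> nform (ev L) = L.
Proof. by case: L => [|x s] //= rs; rewrite nformB nform_prodAB //= addr0. Qed.

Lemma reduced_nonzeros s : nonzeros s -> reduced_tail s.
Proof. by elim: s => //= y s IHs /andP[-> /IHs]. Qed.

Lemma reduced_tail_rcons s y : reduced_tail (rcons s y) = nonzeros s.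
Proof.
elim: s => [|z s IHs] /=; first by rewrite orbT.
rewrite IHs; suff /negPf -> : rcons s y != [::] by rewrite orbF.
by case: (s).
Qed.

Lemma prodAB_inj s s' : nonzeros s -> nonzeros s' -> prodAB s = prodAB s' -> s = s'.
Proof.
move=> /reduced_nonzeros rs /reduced_nonzeros rs' /(congr1 nform).
by rewrite !nform_prodAB // => -[].
Qed.

End NormalForm.

(** * Word length *)

Lemma min_natE (A : set nat) n :
  A n -> (forall p, A p -> (n <= p)%N) -> min_nat A = n.
Proof.
move=> An le_n; rewrite /min_nat; case: xgetP => [p -> [Ap le_p]|no].
  by apply/eqP; rewrite eqn_leq le_n // le_p.
by exfalso; apply: (no n).
Qed.

Section WordLength.
Local Open Scope quotient_scope.
Local Open Scope group_scope.
Variable m : nat.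
Hypothesis m_gt0 : (0 < m)%N.
Local Notation K := 'Z_(2 * m).
Local Notation G := (heckeG m).
Local Notation a := (genA m).
Local Notation b := (genB m).

(** The distance from y to 0 around the cycle of residues, which is the number of letters b or b^-1
    needed to spell b^y. *)
Definition nrm (y : K) : nat := minn y (2 * m - y).

Definition weight (s : seq K) : nat := \sum_(y <- s) (nrm y).+1.

Definition nform_weight (L : seq K) : nat :=
  if L is x :: s then nrm x + weight s else 0.

(** The carrier of ['Z_(2 * m)] is an ordinal type of size [(Zp_trunc (2 * m)).+2]; this size is the
    intended one because m > 0. *)
Lemma Zp_trunc_2m : (Zp_trunc (2 * m)).+2 = (2 * m)%N.
Proof. by rewrite Zp_cast //; lia. Qed.

Lemma ltn_2m (y : K) : (y < 2 * m)%N.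
Proof. by rewrite -[X in (_ < X)%N]Zp_trunc_2m ltn_ord. Qed.

Lemma val_K1 : nat_of_ord (1%R : K) = 1%N.
Proof. by []. Qed.

Lemma val_KD (y z : K) : nat_of_ord (y + z)%R = ((y + z) %% (2 * m))%N.
Proof. by rewrite -[X in (_ %% X)%N]Zp_trunc_2m. Qed.

Lemma val_KN (y : K) : nat_of_ord (- y)%R = ((2 * m - y) %% (2 * m))%N.
Proof. by rewrite -![X in X - _]Zp_trunc_2m -[X in (_ %% X)%N]Zp_trunc_2m. Qed.

Lemma val_Kn n : nat_of_ord (n%:R : K)%R = (n %% (2 * m))%N.
Proof. by rewrite val_Zp_nat //; lia. Qed.

Lemma nrm0 : nrm 0%R = 0%N.
Proof. by rewrite /nrm min0n. Qed.

Lemma nrmN y : nrm (- y)%R = nrm y.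
Proof.
have := ltn_2m y; rewrite /nrm val_KN.
case: (posnP y) => [->|y0] lt; first by rewrite !subn0 modnn subn0 !min0n.
by rewrite modn_small; lia.
Qed.

Lemma nrm_add1 y : (nrm (1 + y)%R <= (nrm y).+1)%N.
Proof.
have lt := ltn_2m y; rewrite /nrm val_KD val_K1 add1n.
have [->|ne] := eqVneq (nat_of_ord y).+1 (2 * m)%N; first by rewrite modnn min0n.
by rewrite modn_small; lia.
Qed.

Lemma nrm_sub1 y : (nrm (-1 + y)%R <= (nrm y).+1)%N.
Proof.
rewrite -nrmN opprD opprK; apply: (leq_trans (nrm_add1 _)); by rewrite nrmN.
Qed.

Lemma nrm_repr y : y = (nrm y)%:R%R \/ y = (- (nrm y)%:R)%R.
Proof.
have lt := ltn_2m y; rewrite /nrm.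
have [le|lt'] := leqP y (2 * m - y); [left|right].
  by apply/ord_inj; rewrite val_Kn modn_small.
apply: oppr_inj; rewrite opprK; apply/ord_inj.
by rewrite val_KN val_Kn.
Qed.

Lemma weight_nil : weight [::] = 0%N.
Proof. by rewrite /weight big_nil. Qed.

Lemma weight_cons y s : weight (y :: s) = ((nrm y).+1 + weight s)%N.
Proof. by rewrite /weight big_cons. Qed.

Lemma weight_cat s1 s2 : weight (s1 ++ s2) = (weight s1 + weight s2)%N.
Proof. by rewrite /weight big_cat. Qed.

(** The w' of the overview; on group elements it sends g to a g^-1 a, see [prodAB_revopp]. *)
Definition revopp (s : seq K) : seq K := rev (map -%R%R s).

Lemma weight_revopp s : weight (revopp s) = weight s.
Proof.
rewrite /weight /revopp (perm_big _ (permEl (perm_rev _))) big_map.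
by apply: eq_bigr => y _; rewrite nrmN.
Qed.

Definition gens : seq G := [:: a; b; b^-1].

Definition spelled (n : nat) (g : G) : Prop := exists s : seq G,
  [/\ size s = n, {subset s <= gens} & \prod_(x <- s) x = g].

Lemma spelled1 : spelled 0 1.
Proof. by exists [::]; split; rewrite ?big_nil. Qed.

Lemma spelled_gen g : g \in gens -> spelled 1 g.
Proof.
move=> gS; exists [:: g]; split; rewrite ?big_seq1 // => x.
by rewrite inE => /eqP->.
Qed.

Lemma spelledM n n' g g' : spelled n g -> spelled n' g' -> spelled (n + n') (g * g').
Proof.
move=> [s [<- sS <-]] [s' [<- sS' <-]]; exists (s ++ s').
split; rewrite ?size_cat ?big_cat // => x.
by rewrite mem_cat => /orP[/sS|/sS'].
Qed.

Lemma spelledX n g k : spelled n g -> spelled (k * n) (g ^+ k).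
Proof.
move=> gn; elim: k => [|k IHk]; first exact: spelled1.
by rewrite expgS mulSn; apply: spelledM.
Qed.

Lemma spelled_powB y : spelled (nrm y) (powB y).
Proof.
rewrite -[nrm y]muln1.
case: (nrm_repr y) => [{2}->|{2}->]; rewrite ?powBN powBMn -?expVgn; apply: spelledX;
  by apply: spelled_gen; rewrite !inE eqxx ?orbT.
Qed.

Lemma spelled_prodAB (s : seq K) : spelled (weight s) (prodAB s).
Proof.
elim: s => [|y s IHs]; first by rewrite weight_nil prodAB_nil; exact: spelled1.
rewrite weight_cons prodAB_cons; apply: spelledM => //.
rewrite -add1n; apply: spelledM (spelled_powB y).
by apply: spelled_gen; rewrite mem_head.
Qed.

Lemma spelled_nform g : spelled (nform_weight (nform g)) g.
Proof.
rewrite -{2}(ev_nform g); case: (nform g) => [|x s] /=; first exact: spelled1.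
by apply: spelledM; [exact: spelled_powB|exact: spelled_prodAB].
Qed.

(** Multiplying on the left by one generator raises [nform_weight] by at most 1: b and b^-1 move the
    first exponent by one step, and a inserts or removes an exponent 0. *)
Lemma spelled_weight n g : spelled n g -> (nform_weight (nform g) <= n)%N.
Proof.
case=> [s [<- sS <-]]; elim: s sS => [|x s IHs] sS.
  by rewrite big_nil nform1 /= nrm0 weight_nil.
rewrite big_cons /=.
have {IHs}: (nform_weight (nform (\prod_(x <- s) x)) <= size s)%N.
  by apply: IHs => y ys; apply: sS; rewrite inE ys orbT.
move: (\prod_(x <- s) x)%g => h le.
have /sS : x \in x :: s by exact: mem_head.
have addB y : (forall z, nrm (y + z)%R <= (nrm z).+1)%N ->
    (nform_weight (actB y (nform h)) <= (size s).+1)%N.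
  move=> leD; case: (nform h) le => [|z L] //=.
  move=> le; apply: leq_trans (leq_add (leD z) (leqnn _)) _.
  by rewrite addSn ltnS.
rewrite !inE => /or3P[] /eqP->.
- rewrite nformA; case: (nform h) le => [|z L] //=.
  case: eqP => [->|_] /=; last by rewrite nrm0 weight_cons addSn ltnS.
  case: L => [|y L] /=; first by rewrite nrm0 weight_cons weight_nil nrm0.
  by rewrite weight_cons nrm0; lia.
- by rewrite [b](_ : _ = powB 1%R) // nformB; apply: addB; exact: nrm_add1.
- have -> : b^-1 = powB (-1)%R by rewrite powBN.
  by rewrite nformB; apply: addB; exact: nrm_sub1.
Qed.

Lemma hlengthE g : hlength g = nform_weight (nform g).
Proof.
apply: min_natE => [|p]; first exact: spelled_nform.
exact: spelled_weight.
Qed.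

Lemma spelled_hlength g : spelled (hlength g) g.
Proof. by rewrite hlengthE; exact: spelled_nform. Qed.

Lemma hlength_le n g : spelled n g -> (hlength g <= n)%N.
Proof. by rewrite hlengthE; exact: spelled_weight. Qed.

Lemma hlength_prodAB s : reduced_tail s -> hlength (prodAB s) = weight s.
Proof. by move=> rs; rewrite hlengthE nform_prodAB //= nrm0. Qed.

Lemma prodAB_nseq N (s : seq K) : prodAB (flatten (nseq N s)) = prodAB s ^+ N.
Proof.
by elim: N => [|N IHN]; rewrite ?prodAB_nil //= prodAB_cat IHN expgS.
Qed.

Lemma nonzeros_nseq N (s : seq K) : nonzeros s -> nonzeros (flatten (nseq N s)).
Proof. by move=> ns; elim: N => //= N IHN; rewrite /nonzeros all_cat; apply/andP. Qed.

Lemma weight_nseq N s : weight (flatten (nseq N s)) = (N * weight s)%N.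
Proof. by elim: N => [|N IHN]; rewrite ?weight_nil //= weight_cat IHN mulSn. Qed.

(* Comparing the N-th powers of a cyclically reduced element and of a
   conjugate: the conjugating element contributes a bounded length only. *)
Lemma hlength_conj_prodAB s g :
  nonzeros s -> (weight s <= hlength (prodAB s ^ g))%N.
Proof.
move=> ns; rewrite leqNgt; apply/negP => lt.
(* If conjugation shortened the word, each of the N factors would gain at least 1; N = c + 1 exceeds
   the cost c of the two conjugating factors. *)
pose c := (hlength g + hlength g^-1)%N; pose N := c.+1.
have e : prodAB (flatten (nseq N s)) = g * (prodAB s ^ g) ^+ N * g^-1.
  by rewrite -conjXg conjgE prodAB_nseq !mulgA mulgV mul1g mulgK.
have : (hlength (prodAB (flatten (nseq N s)))
   <= hlength g + N * hlength (prodAB s ^ g) + hlength g^-1)%N.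
  rewrite e; apply: hlength_le; apply: spelledM (spelled_hlength _).
  apply: spelledM (spelled_hlength _) _; apply: spelledX; exact: spelled_hlength.
rewrite hlength_prodAB ?reduced_nonzeros ?nonzeros_nseq // weight_nseq.
have : (N * hlength (prodAB s ^ g) + N <= N * weight s)%N.
  by rewrite -mulnSr leq_mul2l lt orbT.
rewrite /N /c; lia.
Qed.

Lemma geod_length_prodAB s :
  nonzeros s -> geod_length (conj_class (prodAB s)) = weight s.
Proof.
move=> ns; apply: min_natE.
  exists (prodAB s); last by rewrite hlength_prodAB // reduced_nonzeros.
  by exists 1 => //; rewrite conjg1.
by move=> _ [_ [g _ <-] <-]; exact: hlength_conj_prodAB.
Qed.

End WordLength.

(** * Conjugacy of cyclically reduced elements *)

Section Conjugacy.
Local Open Scope quotient_scope.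
Local Open Scope group_scope.
Variable m : nat.
Local Notation K := 'Z_(2 * m).
Local Notation G := (heckeG m).
Local Notation a := (genA m).

(** Each letter changes the first entry, inserts one entry or deletes one, so a word affects only a
    part of the list bounded by its own length. *)
Lemma actw_suffix u (L : seq K) : exists p j,
  [/\ actw u L = p ++ drop j L, (size p <= size u)%N & (j <= size u)%N].
Proof.
elim: u => [|l u [p [j [e sp lj]]]] /=; first by exists [::], 0%N; rewrite drop0.
have keep : exists p' j', [/\ p ++ drop j L = p' ++ drop j' L,
    (size p' <= (size u).+1)%N & (j' <= (size u).+1)%N].
  by exists p, j; split => //; exact: leqW.
have dropS y s : drop j L = y :: s -> drop j.+1 L = s.
  by move=> ej; rewrite -[LHS]/(drop (1 + j) L) -drop_drop ej /= drop0.
rewrite e; case: l => [x|y] /=.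
  case: ifP => // _; case: p {e} sp keep => [|x0 p] /= sp keep.
    case ej: (drop j L) keep => [|y s] keep //=.
    case: ifP => _; first by exists [::], j.+1; rewrite (dropS _ _ ej).
    by exists [:: 0%R], j; rewrite ej; split=> //; exact: leqW.
  case: ifP => _; first by exists p, j; split=> //; lia.
  by exists (0%R :: x0 :: p), j; split=> //; lia.
case: p {e} sp keep => [|x0 p] /= sp keep.
  case ej: (drop j L) keep => [|z s] keep //=.
  by exists [:: (y + z)%R], j.+1; rewrite (dropS _ _ ej).
by exists ((y + x0)%R :: p), j; split=> //=; lia.
Qed.

Definition act_prodAB (t L : seq K) : seq K :=
  foldr (fun y L' => actA (actB y L')) L t.

Lemma nform_prodABM t g : nform (prodAB t * g) = act_prodAB t (nform g).
Proof.
elim: t => [|y t IHt] /=; first by rewrite prodAB_nil mul1g.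
by rewrite prodAB_cons -!mulgA nformA nformB IHt.
Qed.

Lemma act_prodAB0 t L : nonzeros t -> act_prodAB t (0%R :: L) = 0%R :: t ++ L.
Proof.
by elim: t => //= y t IHt /andP[ny nt]; rewrite IHt //= addr0 (negPf ny).
Qed.

(** Cancellation runs backwards through t and uses up one entry of L per entry of t; it stops before
    L is exhausted, and what is left of t then survives as a prefix. *)
Lemma act_prodAB_prefix t L : nonzeros t -> L != [::] -> (size L <= size t)%N ->
  exists i q, [/\ act_prodAB t L = 0%R :: take i t ++ q, (i <= size t)%N,
     (size t <= i + size L)%N & (size q <= size L)%N].
Proof.
elim/last_ind: t L => [|t y IHt] [|k L] //.
rewrite /nonzeros all_rcons => /andP[ny nt] _; rewrite size_rcons /= ltnS => le.
rewrite /act_prodAB foldr_rcons /= -/(act_prodAB _ _).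
case: ifP => [/andP[_ nL]|_].
  have [i [q [-> le1 le2 le3]]] := IHt _ nt nL le.
  exists i, q; split; [by rewrite -cats1 takel_cat|exact: leqW|by rewrite addnS|exact: leqW].
rewrite act_prodAB0 //; exists (size t), ((y + k)%R :: L); split=> //=; try lia.
by rewrite -cats1 take_size_cat.
Qed.

Definition cyc (s : seq K) (x : int) : K := nth 0%R s `|(x %% size s)%Z|.

Lemma cyc_nat s (i : nat) : cyc s i = nth 0%R s (i %% size s).
Proof. by rewrite /cyc modz_nat. Qed.

Lemma cyc_mod s x y : (x = y %[mod size s])%Z -> cyc s x = cyc s y.
Proof. by rewrite /cyc => ->. Qed.

Lemma nth_flatten_nseq N (s : seq K) i : (i < N * size s)%N ->
  nth 0%R (flatten (nseq N s)) i = nth 0%R s (i %% size s).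
Proof.
elim: N i => [|N IHN] i //=; rewrite mulSn nth_cat => lt.
case: ltnP => le; first by rewrite modn_small.
by rewrite IHN; [rewrite -{2}(subnK le) modnDr | lia].
Qed.

Lemma size_flatten_nseq N (s : seq K) : size (flatten (nseq N s)) = (N * size s)%N.
Proof. by elim: N => //= N IHN; rewrite size_cat IHN [RHS]mulSn. Qed.

(* If prodAB s' = z (prodAB s) z^-1, the normal forms of (prodAB s')^N z and
   z (prodAB s)^N agree; away from a bounded number of entries at either end
   they read the periodic sequences s' and s. *)
Lemma conj_prodAB_cyc s s' g : nonzeros s -> nonzeros s' ->
  s != [::] -> s' != [::] -> prodAB s ^ g = prodAB s' ->
  size s = size s' /\ exists d : int, forall x, cyc s' x = cyc s (x + d)%R.
Proof.
move=> ns ns' s0 s'0 eg; pose z := g^-1; pose u := repr z.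
have [c cE] : exists c, c = (size u).+1 by exists (size u).+1.
(* All boundary effects have size at most c, so 4c copies keep a full period starting at index
   [c * size s] clear of both ends. *)
have [N NE] : exists N, N = (4 * c)%N by exists (4 * c)%N.
pose t := flatten (nseq N s); pose t' := flatten (nseq N s').
have sz : (0 < size s)%N by case: (s) s0.
have sz' : (0 < size s')%N by case: (s') s'0.
have st : size t = (N * size s)%N by exact: size_flatten_nseq.
have st' : size t' = (N * size s')%N by exact: size_flatten_nseq.
have e : prodAB t' * z = z * prodAB t.
  by rewrite !prodAB_nseq -eg -conjXg conjgE -!mulgA mulgV mulg1.
have {}e : nform (prodAB t' * z) = nform (z * prodAB t) by rewrite e.
have lz : nform z != [::] by have := reduced_nform z; case: (nform z).
have cz : (size (nform z) <= c)%N.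
  have [p [j [ep sp _]]] := actw_suffix u [:: 0%R].
  rewrite /nform -/u ep size_cat size_drop cE /=; lia.
rewrite nform_prodABM -[X in X * prodAB t](reprK z) nform_word -/u in e.
rewrite nform_prodAB ?reduced_nonzeros ?nonzeros_nseq // in e.
have [|i [q [ei le_i ge_i sq]]] := act_prodAB_prefix (nonzeros_nseq N ns') lz.
  by apply: leq_trans cz _; rewrite st' NE; nia.
have [p [j [ep sp lj]]] := actw_suffix u (0%R :: t).
rewrite -/t' in ei le_i ge_i; rewrite ei ep in e.
have se : ((i + size q).+1 = size p + ((N * size s).+1 - j))%N.
  have := congr1 size e.
  by rewrite /= !size_cat size_drop size_takel //= st.
rewrite st' in ge_i le_i.
have {}ge_i : (N * size s' <= i + c)%N by apply: (leq_trans ge_i); rewrite leq_add2l.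
have {}sq : (size q <= c)%N by exact: leq_trans cz.
have {}sp : (size p <= c)%N by rewrite cE; exact: leqW.
have {}lj : (j <= c)%N by rewrite cE; exact: leqW.
have c_gt0 : (0 < c)%N by rewrite cE.
(* The total lengths [N * size s] and [N * size s'] differ by at most 2c, which is less than N. *)
have n_eq : size s = size s'.
  have leN : (N <= N * size s)%N by rewrite leq_pmulr.
  have lt1 : (N * size s < N * (size s').+1)%N by rewrite mulnS; lia.
  have lt2 : (N * size s' < N * (size s).+1)%N by rewrite mulnS; lia.
  rewrite !ltn_mul2l !ltnS in lt1 lt2.
  by apply/eqP; rewrite eqn_leq; case/andP: lt1 => _ ->; case/andP: lt2.
(* The shift is the number of entries deleted minus the number of entries put in front. The index k
   below represents x modulo the period, inside the window where both sides are periodic. *)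
split=> //; exists (Posz j - Posz (size p))%R => x.
pose k := (c * size s + `|(x %% size s)%Z|)%N.
have ltx : (`|(x %% size s)%Z| < size s)%N.
  by rewrite -ltz_nat gez0_abs ?modz_ge0 ?ltz_pmod ?ltz_nat //; lia.
have ltk : (k < i)%N by rewrite /k; move: ge_i; rewrite -n_eq NE; nia.
have gek : (c <= k)%N by rewrite /k; nia.
have := congr1 (nth 0%R ^~ k.+1) e.
rewrite /= nth_cat size_takel ?st' // ltk nth_take // nth_cat.
rewrite ltnNge (_ : size p <= k.+1)%N /=; last lia.
rewrite nth_drop (_ : j + (k.+1 - size p) = (j + (k - size p)).+1)%N /=; last lia.
rewrite !nth_flatten_nseq; [|lia|lia].
rewrite -!cyc_nat => ek.
transitivity (cyc s' k).
  apply: cyc_mod; rewrite -n_eq /k PoszD PoszM modzMDl.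
  by rewrite gez0_abs ?modz_mod // modz_ge0 //; lia.
rewrite ek; apply: cyc_mod.
have -> : (Posz (j + (k - size p)) =
  Posz c * Posz (size s) + (Posz `|(x %% size s)%Z|%N + (Posz j - Posz (size p))))%R.
  by rewrite -PoszM; lia.
rewrite modzMDl gez0_abs ?modz_ge0 //; last by lia.
by rewrite modzDml.
Qed.

End Conjugacy.

(** * Folded cyclic words *)

Section Folding.
Local Open Scope quotient_scope.
Local Open Scope group_scope.
Variable m : nat.
Hypothesis m_gt0 : (0 < m)%N.
Local Notation K := 'Z_(2 * m).
Local Notation G := (heckeG m).

(** The exponent of the involution b^m: the only nonzero residue equal to its opposite, by [midN]
    and [oppK_eq]. *)
Definition mid : K := (m%:R)%R.

Lemma midN : (- mid = mid)%R.
Proof.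
apply/ord_inj; rewrite val_KN // val_Kn // (modn_small (_ : m < _)%N); last lia.
by rewrite modn_small; lia.
Qed.

Lemma mid_neq0 : mid != 0%R.
Proof.
rewrite -(inj_eq (@ord_inj _)) val_Kn // modn_small; last lia.
by rewrite -lt0n.
Qed.

Lemma nrm_mid : nrm mid = m.
Proof.
rewrite /nrm val_Kn // modn_small; last lia.
by lia.
Qed.

Lemma oppK_eq (y : K) : (- y = y)%R -> y != 0%R -> y = mid.
Proof.
move=> e ny; apply/ord_inj; rewrite val_Kn // modn_small; last lia.
have := congr1 (@nat_of_ord _) e; rewrite val_KN //.
have := ltn_2m m_gt0 y; move: ny; rewrite -(inj_eq (@ord_inj _)) -lt0n => ny lt.
by rewrite modn_small /=; lia.
Qed.

Lemma revoppK : involutive (@revopp m).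
Proof.
move=> s; rewrite /revopp map_rev revK -map_comp map_id_in // => y _ /=.
by rewrite opprK.
Qed.

Lemma size_revopp (s : seq K) : size (revopp s) = size s.
Proof. by rewrite size_rev size_map. Qed.

Lemma revopp_cat (s1 s2 : seq K) : revopp (s1 ++ s2) = revopp s2 ++ revopp s1.
Proof. by rewrite /revopp map_cat rev_cat. Qed.

Lemma nonzeros_cat (s1 s2 : seq K) :
  nonzeros (s1 ++ s2) = nonzeros s1 && nonzeros s2.
Proof. exact: all_cat. Qed.

Lemma nonzeros_revopp (s : seq K) : nonzeros (revopp s) = nonzeros s.
Proof.
by rewrite /nonzeros all_rev all_map; apply: eq_all => y /=; rewrite oppr_eq0.
Qed.

(* lia identifies size terms only when their type arguments agree
   syntactically. *)
Local Ltac slia := simpl in *; lia.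

Lemma nth_revopp (s : seq K) i : (i < size s)%N ->
  nth 0%R (revopp s) i = (- nth 0%R s (size s - i.+1))%R.
Proof.
move=> lt; rewrite nth_rev size_map // (nth_map 0%R) // ltn_subrL /=.
exact: leq_ltn_trans lt.
Qed.

(* The cyclic words of the commutators [a, h] and [b^m, h]. *)
Definition fold2 (w : seq K) : seq K := w ++ revopp w.
Definition foldk (w : seq K) : seq K := (w ++ mid :: revopp w) ++ [:: mid].

Lemma size_fold2 w : size (fold2 w) = (2 * size w)%N.
Proof. by rewrite size_cat size_revopp [RHS]mul2n addnn. Qed.

Lemma size_foldk w : size (foldk w) = (2 * (size w).+1)%N.
Proof. by rewrite !size_cat /= size_revopp; lia. Qed.

Lemma nonzeros_fold2 w : nonzeros (fold2 w) = nonzeros w.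
Proof. by rewrite nonzeros_cat nonzeros_revopp andbb. Qed.

Lemma nonzeros_foldk w : nonzeros (foldk w) = nonzeros w.
Proof.
rewrite !nonzeros_cat {2 3}/nonzeros /= -/(nonzeros _) nonzeros_revopp mid_neq0.
by rewrite !andbT andbb.
Qed.

Lemma weight_fold2 w : weight (fold2 w) = (2 * weight w)%N.
Proof. by rewrite weight_cat weight_revopp // [RHS]mul2n addnn. Qed.

Lemma weight_foldk w : weight (foldk w) = (2 * (weight w + m.+1))%N.
Proof.
by rewrite !weight_cat !weight_cons weight_revopp // weight_nil nrm_mid; lia.
Qed.

Lemma fold2_inj : injective fold2.
Proof.
move=> w w' e; have := congr1 size e; rewrite !size_fold2 => es.
have {}es : size w = size w' by lia.
by move/eqP: e; rewrite /fold2 eqseq_cat // => /andP[/eqP].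
Qed.

Lemma foldk_inj : injective foldk.
Proof.
move=> w w' e; have := congr1 size e; rewrite !size_foldk => es.
have {}es : size w = size w' by lia.
by move/eqP: e; rewrite /foldk -!catA eqseq_cat // => /andP[/eqP].
Qed.

Lemma cyc_eq (s s' : seq K) : size s = size s' -> (forall x, cyc s x = cyc s' x) -> s = s'.
Proof.
move=> es e; apply: (@eq_from_nth _ 0%R) => // i lt.
by have := e i; rewrite !cyc_nat -es modn_small.
Qed.

(** It is enough to test the reflection on the indices of one period, where the mirror image of i is
    the residue of -c - i. *)
Lemma cyc_reflect (s : seq K) (c : nat) :
  (0 < size s)%N ->
  (forall i j, (i < size s)%N -> (j < size s)%N -> (size s %| i + j + c)%N ->
     nth 0%R s j = (- nth 0%R s i)%R) ->
  forall x : int, (cyc s (- c%:Z - x) = - cyc s x)%R.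
Proof.
move=> s_gt0 sym x; rewrite /cyc.
have ge0 y : (0 <= (y %% size s)%Z)%R by rewrite modz_ge0 //; lia.
have lt y : (`|(y %% size s)%Z| < size s)%N.
  by rewrite -ltz_nat gez0_abs // ltz_pmod // ltz_nat.
apply: sym => //; rewrite -[_ %| _]/(dvdz (Posz _) (Posz _)) !PoszD.
apply/dvdz_mod0P; rewrite !gez0_abs // -addrA modzDml addrCA modzDml.
by rewrite (_ : _ + _ = 0)%R ?mod0z //; lia.
Qed.

(** The centre of this reflection is -1/2, between two entries; for [foldk] below it is -1, the
    position of the final [mid]. [class2_classk] rests on this difference of parity. *)
Lemma cyc_fold2 w x : w != [::] -> (cyc (fold2 w) (-1 - x) = - cyc (fold2 w) x)%R.
Proof.
move=> w0; have wgt : (0 < size w)%N by case: (w) w0.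
rewrite -[(-1)%R]/(- 1%:Z)%R; apply: cyc_reflect; rewrite size_fold2; first by rewrite muln_gt0.
have main i j : (i < size w)%N -> (i + j + 1 = 2 * size w)%N ->
    (nth 0 (fold2 w) j = - nth 0 (fold2 w) i)%R.
  move=> lti e; rewrite !nth_cat lti.
  case: ltnP => ltj; first by exfalso; slia.
  by rewrite nth_revopp; [congr (- nth _ _ _)%R|]; slia.
move=> i j lti ltj /dvdnP[q e].
(* This multiple of [2 * size w] lies strictly between 0 and [4 * size w]. *)
have {e q}e : (i + j + 1 = 2 * size w)%N.
  by case: q e => [|[|q]]; rewrite ?mulSn; slia.
case: (ltnP i (size w)) => lt; first exact: main.
by rewrite (main j i) ?opprK //; slia.
Qed.

Lemma cyc_foldk w x : (cyc (foldk w) (-2 - x) = - cyc (foldk w) x)%R.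
Proof.
rewrite -[(-2)%R]/(- 2%:Z)%R; apply: cyc_reflect; rewrite size_foldk; first by rewrite muln_gt0.
have last_mid i : (i = 2 * size w + 1)%N -> nth 0%R (foldk w) i = mid.
  move=> ->; rewrite nth_cat size_cat /= size_revopp ifF; last slia.
  by rewrite (_ : _ - _ = 0)%N //; slia.
have centre : nth 0%R (foldk w) (size w) = mid.
  by rewrite /foldk -catA nth_cat ltnn subnn.
have main i j : (i <= size w)%N -> (i + j = 2 * size w)%N ->
    (nth 0 (foldk w) j = - nth 0 (foldk w) i)%R.
  rewrite leq_eqVlt => /orP[/eqP-> e|lt e].
    have -> : j = size w by slia.
    by rewrite centre midN.
  have ltj : (j < size w)%N = false by slia.
  have ej : (j - size w = (j - (size w).+1).+1)%N by slia.
  have ltj' : (j - (size w).+1 < size w)%N by slia.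
  rewrite /foldk -catA [in RHS]nth_cat lt [LHS]nth_cat ltj ej [LHS]/= nth_cat.
  rewrite size_revopp ltj'.
  by rewrite nth_revopp //; congr (- nth _ _ _)%R; slia.
move=> i j lti ltj /dvdnP[q e].
(* The second case occurs only for i and j both equal to the last index, whose entry is [mid]. *)
have [{e q}e|{e q}e] : (i + j = 2 * size w \/ i + j = 4 * size w + 2)%N.
- case: q e => [|[|[|q]]]; rewrite ?mulSn; slia.
- case: (leqP i (size w)) => lt; first exact: main.
  by rewrite (main j i) ?opprK //; slia.
- by rewrite !last_mid ?midN //; slia.
Qed.

(** * Periods and reflections of cyclic words *)

Definition period (s : seq K) (d : int) : Prop :=
  forall x, cyc s (x + d)%R = cyc s x.

Lemma period_size s : period s (size s).
Proof. by move=> x; apply: cyc_mod; rewrite modzDr. Qed.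

Lemma periodB s d d' : period s d -> period s d' -> period s (d - d')%R.
Proof. by move=> pd pd' x; rewrite -pd' addrA subrK. Qed.

Lemma period0 s : period s 0%R.
Proof. by move=> x; rewrite addr0. Qed.

Lemma periodN s d : period s d -> period s (- d)%R.
Proof. by move=> pd; rewrite -sub0r; exact: (periodB (period0 s) pd). Qed.

Lemma periodM s d k : period s d -> period s (k * d)%R.
Proof.
move=> pd; have nat_case n : period s (n%:Z * d)%R.
  elim: n => [|n IHn]; first by rewrite mul0r; exact: period0.
  rewrite (_ : _ * _ = n%:Z * d - - d)%R; last by lia.
  by apply: periodB => //; exact: periodN.
case: k => n //; rewrite NegzE mulNr; exact: periodN.
Qed.

Lemma periodD s d d' : period s d -> period s d' -> period s (d + d')%R.
Proof. by move=> pd pd'; rewrite -[d']opprK; apply: periodB => //; exact: periodN. Qed.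

(** Carried over to s, the reflection of s' has its centre moved by d; the product of the two
    reflections of s is the translation by 2d. *)
Lemma shift_reflect_period (s s' : seq K) (c d : int) :
  (forall x, cyc s' x = cyc s (x + d)%R) ->
  (forall x, cyc s (- c - x) = - cyc s x)%R ->
  (forall x, cyc s' (- c - x) = - cyc s' x)%R -> period s (2 * d)%R.
Proof.
move=> e r r' x; apply: oppr_inj; rewrite -(r x).
have := r' (x + d)%R; rewrite !e (_ : x + d + d = x + 2 * d)%R; last lia.
by move=> <-; congr cyc; lia.
Qed.

(* If 2d and 2d' are periods, so is twice the gcd of d and d', and one of
   d, d', d - d' is an even multiple of that gcd. *)
Lemma period_halves s d d' : period s (2 * d)%R -> period s (2 * d')%R ->
  [\/ period s d, period s d' | period s (d' - d)%R].
Proof.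
move=> p p'; have [u [v e]] := Bezoutz d d'.
set g := gcdz d d' in e.
have pg : period s (2 * g)%R.
  rewrite (_ : 2 * g = u * (2 * d) + v * (2 * d'))%R; last by rewrite -e; lia.
  by apply: periodD; exact: periodM.
have /dvdzP[q eq] : (g %| d)%Z by exact: dvdz_gcdl.
have /dvdzP[q' eq'] : (g %| d')%Z by exact: dvdz_gcdr.
have par (z : int) : (exists k, z = 2 * k)%R \/ (exists k, z = 2 * k + 1)%R.
  have := divz_eq z 2; have := ltz_pmod z (_ : 0 < 2)%R; have := modz_ge0 z (_ : 2 != 0 :> int)%R.
  move=> /(_ isT) ge /(_ isT) lt ez.
  have [r|r] : ((z %% 2)%Z = 0 \/ (z %% 2)%Z = 1)%R by lia.
  - by left; exists (z %/ 2)%Z; lia.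
  - by right; exists (z %/ 2)%Z; lia.
have even_mul z k : (z = 2 * k * g)%R -> period s z.
  by move=> ->; rewrite (_ : 2 * k * g = k * (2 * g))%R; [exact: periodM|lia].
case: (par q) => -[k ek]; first by constructor 1; apply: (even_mul _ k); rewrite eq ek.
case: (par q') => -[k' ek']; first by constructor 2; apply: (even_mul _ k'); rewrite eq' ek'.
(* Both quotients by g are odd here, so their difference is even. *)
constructor 3; apply: (even_mul _ (k' - k))%R; rewrite eq' eq ek ek'; lia.
Qed.

(** Both 2 d1 and 2 d2 are periods of s, so by [period_halves] one of d1, d2, d2 - d1 is a period,
    which identifies two of the three words. *)
Lemma reflect_fibre (s s1 s2 : seq K) (c d1 d2 : int) :
  size s = size s1 -> size s = size s2 ->
  (forall x, cyc s1 x = cyc s (x + d1)%R) ->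
  (forall x, cyc s2 x = cyc s (x + d2)%R) ->
  (forall x, cyc s (- c - x) = - cyc s x)%R ->
  (forall x, cyc s1 (- c - x) = - cyc s1 x)%R ->
  (forall x, cyc s2 (- c - x) = - cyc s2 x)%R ->
  [\/ s = s1, s = s2 | s1 = s2].
Proof.
move=> z1 z2 e1 e2 r r1 r2.
have p1 := shift_reflect_period e1 r r1.
have p2 := shift_reflect_period e2 r r2.
case: (period_halves p1 p2) => p; [constructor 1|constructor 2|constructor 3].
- by apply: cyc_eq => // x; rewrite e1 p.
- by apply: cyc_eq => // x; rewrite e2 p.
- apply: cyc_eq => [|x]; first by rewrite -z1.
  by rewrite e1 e2 -(p (x + d1)%R); congr cyc; lia.
Qed.

(** * Conjugacy classes of folded words *)

Lemma conj_class_eq (gT : groupType) (x y : gT) :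
  conj_class x = conj_class y -> exists g, x ^ g = y.
Proof.
move=> e; have : conj_class y y by exists 1 => //; rewrite conjg1.
by rewrite -e => -[g _ eg]; exists g.
Qed.

Lemma conj_class_conj (gT : groupType) (x g : gT) : conj_class (x ^ g) = conj_class x.
Proof. by symmetry; apply: conj_classE; exists g. Qed.

Lemma conj_class_mulC (gT : groupType) (x y : gT) : conj_class (x * y) = conj_class (y * x).
Proof. by rewrite -(conj_class_conj (x * y) x) conjgE -!mulgA mulKg. Qed.

Definition class2 w : set G := conj_class (prodAB (fold2 w)).
Definition classk w : set G := conj_class (prodAB (foldk w)).

(** Replacing w by [revopp w] exchanges the two halves of the fold, which is a cyclic shift. In
    [classk_revopp] each half carries its own final [mid]. *)
Lemma class2_revopp w : class2 (revopp w) = class2 w.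
Proof.
by rewrite /class2 /fold2 revoppK !prodAB_cat conj_class_mulC.
Qed.

Lemma classk_revopp w : classk (revopp w) = classk w.
Proof.
rewrite /classk /foldk revoppK.
have fE (s1 s2 : seq K) : (s1 ++ mid :: s2) ++ [:: mid] = (s1 ++ [:: mid]) ++ (s2 ++ [:: mid]).
  by rewrite -!catA.
by rewrite !fE !(prodAB_cat (_ ++ _)) conj_class_mulC.
Qed.

Lemma foldk_neq0 w : foldk w != [::].
Proof. by rewrite -size_eq0 size_foldk mulnS. Qed.

Lemma fold2_neq0 w : w != [::] -> fold2 w != [::].
Proof. by case: w. Qed.

Lemma class2_fibre w w1 w2 : nonzeros w -> nonzeros w1 -> nonzeros w2 ->
  w != [::] -> w1 != [::] -> w2 != [::] ->
  class2 w = class2 w1 -> class2 w = class2 w2 -> [\/ w = w1, w = w2 | w1 = w2].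
Proof.
move=> n n1 n2 w0 w10 w20 /conj_class_eq[g1 e1] /conj_class_eq[g2 e2].
have [||||z1 [d1 {}e1]] := conj_prodAB_cyc _ _ _ _ e1; rewrite ?nonzeros_fold2 ?fold2_neq0 //.
have [||||z2 [d2 {}e2]] := conj_prodAB_cyc _ _ _ _ e2; rewrite ?nonzeros_fold2 ?fold2_neq0 //.
have := @reflect_fibre _ _ _ 1%R _ _ z1 z2 e1 e2.
case=> [x|x|x|/fold2_inj|/fold2_inj|/fold2_inj]; try exact: cyc_fold2;
  by [constructor 1|constructor 2|constructor 3].
Qed.

Lemma classk_fibre w w1 w2 : nonzeros w -> nonzeros w1 -> nonzeros w2 ->
  classk w = classk w1 -> classk w = classk w2 -> [\/ w = w1, w = w2 | w1 = w2].
Proof.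
move=> n n1 n2 /conj_class_eq[g1 e1] /conj_class_eq[g2 e2].
have [||||z1 [d1 {}e1]] := conj_prodAB_cyc _ _ _ _ e1; rewrite ?nonzeros_foldk ?foldk_neq0 //.
have [||||z2 [d2 {}e2]] := conj_prodAB_cyc _ _ _ _ e2; rewrite ?nonzeros_foldk ?foldk_neq0 //.
have := @reflect_fibre _ _ _ 2%R _ _ z1 z2 e1 e2.
case=> [x|x|x|/foldk_inj|/foldk_inj|/foldk_inj]; try exact: cyc_foldk;
  by [constructor 1|constructor 2|constructor 3].
Qed.

(* The two reflections of the common cyclic word have centres of different
   parity, so their product is an odd period; hence half the length of the
   word is a period. *)
Lemma class2_classk w w' : nonzeros w -> nonzeros w' -> w != [::] ->
  class2 w = classk w' -> revopp w = w.
Proof.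
move=> n n' w0 /conj_class_eq[g e].
have [||||z [d {}e]] := conj_prodAB_cyc _ _ _ _ e;
  rewrite ?nonzeros_foldk ?foldk_neq0 ?nonzeros_fold2 ?fold2_neq0 //.
(* Compose the reflection of [fold2 w] with the one carried over from [foldk w']. *)
have p : period (fold2 w) (2 * d - 1)%R.
  move=> x; have := cyc_foldk w' (-1 - x - d)%R; rewrite !e subrK -cyc_fold2 //.
  rewrite (_ : -1 - (-1 - x) = x)%R; last lia.
  by move=> <-; congr cyc; lia.
(* With n = [size w], this is d (2n) - n (2d - 1) = n. *)
have {}p : period (fold2 w) (size w).
  have := periodB (periodM d (period_size (fold2 w))) (periodM (size w) p).
  by congr period; rewrite size_fold2; lia.
apply: (@eq_from_nth _ 0%R); rewrite size_revopp // => i lt.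
have := p i; rewrite -PoszD !cyc_nat size_fold2 !modn_small; [|lia|lia].
by rewrite !nth_cat lt ltnNge leq_addl /= addnK.
Qed.

End Folding.

(** * Reciprocal geodesics as classes of folded words *)

Section ReciprocalSets.
Local Open Scope quotient_scope.
Local Open Scope group_scope.
Variable m : nat.
Hypothesis m_gt0 : (0 < m)%N.
Local Notation K := 'Z_(2 * m).
Local Notation G := (heckeG m).
Local Notation a := (genA m).
Local Notation b := (genB m).

Lemma prodAB_revopp (s : seq K) : prodAB (revopp s) = a * (prodAB s)^-1 * a.
Proof.
elim: s => [|y s IHs]; first by rewrite prodAB_nil invg1 mulg1 genA2.
rewrite -cat1s revopp_cat prodAB_cat IHs prodAB_cat !prodAB1 !invgM powBN genAV.
by rewrite !mulgA -(mulgA _ a a) genA2 mulg1 -(mulgA _ a a) genA2 mulg1.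
Qed.

Lemma prodAB_fold2 (w : seq K) :
  prodAB (fold2 w) = prodAB w * a * (prodAB w)^-1 * a.
Proof. by rewrite prodAB_cat prodAB_revopp !mulgA. Qed.

Lemma powB_mid2 : powB (mid m) * powB (mid m) = 1.
Proof. by rewrite -powBD -{1}(midN m_gt0) addNr powB0. Qed.

Lemma powB_midV : (powB (mid m))^-1 = powB (mid m).
Proof. by rewrite -powBN midN. Qed.

Lemma powBC (y z : K) : powB y * powB z = powB z * powB y.
Proof. by rewrite -!powBD addrC. Qed.

Lemma prodAB_midfold (w : seq K) :
  prodAB (w ++ mid m :: revopp w) * a = prodAB w * a * powB (mid m) * a * (prodAB w)^-1.
Proof.
rewrite prodAB_cat prodAB_cons prodAB_revopp !mulgA.
by rewrite -(mulgA _ a a) genA2 mulg1.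
Qed.

(** Exhibits the class as that of b^m times its conjugate by [prodAB w * a]. *)
Lemma classkE (w : seq K) : classk w =
  conj_class (powB (mid m) * (prodAB w * a * powB (mid m) * a * (prodAB w)^-1)).
Proof.
rewrite conj_class_mulC -prodAB_midfold /classk /foldk prodAB_cat prodAB1.
by rewrite !mulgA.
Qed.

(** The final 0 meets its mirror image in the middle of the fold and contributes a a = 1. In
    [class2_cons0] the two zeros are at the ends, hence adjacent in the cyclic word. *)
Lemma class2_rcons0 (s : seq K) : class2 (rcons s 0%R) = class2 s.
Proof.
rewrite /class2 /fold2 -cats1 revopp_cat -catA prodAB_cat !catA.
by rewrite prodAB_cat /= !prodAB_cons prodAB_nil oppr0 !powB0 !mulg1 genA2 mul1g -prodAB_cat.
Qed.

Lemma class2_cons0 (s : seq K) : class2 (0%R :: s) = class2 s.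
Proof.
rewrite /class2 /fold2 -cat1s revopp_cat -catA prodAB_cat conj_class_mulC.
rewrite catA -prodAB_cat -catA prodAB_cat /=.
by rewrite !prodAB_cons prodAB_nil oppr0 !powB0 !mulg1 genA2 mulg1.
Qed.

Lemma class2_reduced (L : seq K) : reduced L ->
  exists2 w, nonzeros w & class2 L = class2 w.
Proof.
case: L => [|x T] //; case/lastP: T => [|T y] /= red.
  by have [->|nx] := eqVneq x 0%R; [exists [::]; rewrite ?class2_cons0|exists [:: x]; rewrite //= nx].
rewrite reduced_tail_rcons in red.
have [->|ny] := eqVneq y 0%R.
  rewrite -rcons_cons class2_rcons0; have [->|nx] := eqVneq x 0%R.
    by exists T; rewrite ?class2_cons0.
  by exists (x :: T); rewrite //= nx.
have nr : nonzeros (rcons T y) by rewrite /nonzeros all_rcons ny.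
have [->|nx] := eqVneq x 0%R; first by exists (rcons T y); rewrite ?class2_cons0.
by exists (x :: rcons T y); rewrite //= nx.
Qed.

Lemma conj_class1 (gT : groupType) (x : gT) : conj_class x = conj_class 1 -> x = 1.
Proof. by move/esym/conj_class_eq => [g]; rewrite conj1g. Qed.

Lemma reciprocal_atE (i x y : G) : conj_class i x -> conj_class i y ->
  exists g, conj_class (x * y) = conj_class (i * (g * i * g^-1)).
Proof.
move=> [p _ <-] [q _ <-]; exists (p * q^-1).
rewrite -(conj_class_conj (i ^ p * i ^ q) p^-1); congr conj_class.
by rewrite conjMg conjgK -conjgM conjgE !invgM !invgK !mulgA.
Qed.

Lemma invol_mul1 (i x y : G) : i^-1 = i -> conj_class i y -> x * y = 1 -> x = y.
Proof.
move=> iV [q _ <-] e; have : x^-1 = i ^ q by exact: mulg1_eq.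
by move/(congr1 (fun z => z^-1)); rewrite invgK -conjVg iV.
Qed.

Lemma reciprocal_order2E : reciprocal_order2 m =
  [set class2 w | w in [set w : seq K | nonzeros w /\ w != [::]]].
Proof.
apply/seteqP; split=> [C [x [y [cx cy nxy ->]]]|_ [w [nw w0] <-]].
  have [g eg] := reciprocal_atE cx cy.
  (* [prodAB] of the whole normal form of g is a g, so the fold evaluates to a (g a g^-1). *)
  have e2 : conj_class (x * y) = class2 (nform g).
    rewrite eg /class2 -{1 2}(ev_nform g) prodAB_fold2.
    have := reduced_nform g; case: (nform g) => [|z s] // _.
    by rewrite /= prodAB_cons !invgM genAV !mulgA -(mulgA _ a a) genA2 mulg1.
  have [w nw ew] := class2_reduced (reduced_nform g).
  exists w; last by rewrite -ew e2.
  split=> //; apply/eqP => w0; case/eqP: nxy.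
  apply: (invol_mul1 (genAV m) cy); apply: conj_class1.
  by rewrite e2 ew w0 /class2 prodAB_nil.
exists a, (a ^ (a * prodAB w)^-1).
have e : a * a ^ (a * prodAB w)^-1 = prodAB (fold2 w).
  by rewrite prodAB_fold2 conjgE invgK invgM genAV !mulgA genA2 mul1g.
split; [by exists 1 => //; rewrite conjg1|by exists (a * prodAB w)^-1| |by rewrite e].
apply/eqP => e'; rewrite -e' genA2 -(prodAB_nil m) in e.
have := prodAB_inj (isT : @nonzeros m [::]) _ e; rewrite nonzeros_fold2 => /(_ nw) /esym/eqP.
by rewrite (negPf (fold2_neq0 w0)).
Qed.

Lemma reciprocal_orderkE : reciprocal_orderk m =
  [set classk w | w in [set w : seq K | nonzeros w]].
Proof.
have bm : b ^+ m = powB (mid m) by rewrite -powBMn.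
apply/seteqP; split=> [C [x [y [cx cy nxy ->]]]|_ [w nw <-]].
  rewrite bm in cx cy.
  have [g eg] := reciprocal_atE cx cy; rewrite -(ev_nform g) in eg.
  have := reduced_nform g; case: (nform g) eg => [|z s] // eg.
  case/lastP: s eg => [|w z'] eg /= red.
    (* Here g is a power of b, hence commutes with b^m, and the product would be trivial. *)
    case/eqP: nxy; apply: (invol_mul1 powB_midV cy); apply: conj_class1.
    by rewrite eg /= prodAB_nil mulg1 powBC mulgK powB_mid2.
  rewrite reduced_tail_rcons in red; exists w => //.
  (* Here g = b^z [prodAB w] a b^z'. Conjugation removes b^z, and b^z' commutes with b^m. *)
  rewrite eg classkE -[LHS](conj_class_conj _ (powB z)^-1) /= -cats1 prodAB_cat prodAB1.
  congr conj_class; rewrite conjgE invgK !invgM genAV !mulgA (powBC z (mid m)).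
  by rewrite -(mulgA _ (powB z')) [powB z' * _]powBC mulgA mulgK.
exists (powB (mid m)), (powB (mid m) ^ (prodAB w * a)^-1).
have e : classk w = conj_class (powB (mid m) * powB (mid m) ^ (prodAB w * a)^-1).
  by rewrite classkE conjgE invgK invgM genAV !mulgA.
rewrite /conj_class bm; split; [by exists 1 => //; rewrite conjg1|by exists (prodAB w * a)^-1| |by []].
apply/eqP => e'; rewrite -e' powB_mid2 in e.
have := conj_class1 e; rewrite -(prodAB_nil m) => e1.
have := prodAB_inj _ (isT : @nonzeros m [::]) e1; rewrite nonzeros_foldk // => /(_ nw)/eqP.
by rewrite (negPf (foldk_neq0 m_gt0 w)).
Qed.

(** * Exponents in [Ek] as residues, and the two sets of commutators *)

Definition signed (y : K) : int := if (y <= m)%N then (y%:Z)%R else (y%:Z - (2 * m)%:Z)%R.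

Lemma intr_signed (y : K) : ((signed y)%:~R = y)%R.
Proof.
have natK (z : K) : (z%:R = z)%R.
  by apply/ord_inj; rewrite val_Kn // modn_small // ltn_2m.
rewrite /signed; case: ifP => _; first exact: natK.
rewrite rmorphB /= -!pmulrn natK (_ : (2 * m)%:R = 0)%R ?subr0 //.
by apply/ord_inj; rewrite val_Kn // modnn.
Qed.

Lemma Ek_signed (y : K) : y != 0%R -> Ek m (signed y).
Proof.
have := ltn_2m m_gt0 y; rewrite -(inj_eq (@ord_inj _)) /= /signed => lt ny.
by case: ifP => le; split; lia.
Qed.

Lemma Ek_intr (x : int) : Ek m x -> (x%:~R : K)%R != 0%R.
Proof.
move=> [x0 lo hi]; case: x x0 lo hi => n x0 lo hi.
  by rewrite -pmulrn -(inj_eq (@ord_inj _)) val_Kn //= modn_small; lia.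
rewrite NegzE rmorphN /= oppr_eq0 -pmulrn -(inj_eq (@ord_inj _)) val_Kn //=.
by rewrite modn_small; lia.
Qed.

Lemma expgz_genB (z : int) : expgz b z = powB (z%:~R)%R.
Proof.
case: z => n; first by rewrite -pmulrn powBMn.
by rewrite NegzE rmorphN /= -pmulrn powBN powBMn.
Qed.

Lemma ab_wordE s : ab_word m s = prodAB [seq (x%:~R)%R | x <- s].
Proof. by rewrite /ab_word /prodAB big_map; apply: eq_bigr => x _; rewrite expgz_genB. Qed.

Lemma nonzeros_Ek s : (forall x, x \in s -> Ek m x) ->
  @nonzeros m [seq (x%:~R)%R | x <- s].
Proof. by move=> Es; apply/allP => _ /mapP[x /Es xE ->]; exact: Ek_intr. Qed.

Lemma map_signed (w : seq K) : [seq (x%:~R)%R | x <- map signed w] = w.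
Proof. by rewrite -map_comp map_id_in // => y _ /=; exact: intr_signed. Qed.

Lemma signed_Ek (w : seq K) : nonzeros w -> forall x, x \in map signed w -> Ek m x.
Proof. by move=> /allP nw _ /mapP[y /nw ny ->]; exact: Ek_signed. Qed.

Lemma commutator_bb h : bb_word h <->
  exists w : seq K, [/\ nonzeros w, w != [::] & a * h = prodAB w].
Proof.
split=> [[x0 [s [Es ->]]]|[w [nw w0 e]]].
  exists [seq (x%:~R)%R | x <- x0 :: s]; split=> //; first exact: nonzeros_Ek.
  by rewrite /= prodAB_cons ab_wordE expgz_genB mulgA.
case: w nw w0 e => [|y w] // nw _ e; exists (signed y), (map signed w).
split; first exact: (signed_Ek nw).
by rewrite -(genAK h) e prodAB_cons ab_wordE expgz_genB map_signed intr_signed -mulgA genAK.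
Qed.

Lemma aa_wordE h : aa_word h <-> exists2 w : seq K, nonzeros w & h = prodAB w * a.
Proof.
split=> [[s [Es ->]]|[w nw ->]].
  by exists [seq (x%:~R)%R | x <- s]; [exact: nonzeros_Ek|rewrite ab_wordE].
by exists (map signed w); split; [exact: signed_Ek|rewrite ab_wordE map_signed].
Qed.

Lemma NaaE t : (0 < t)%N -> Naa m t =
  [set prodAB (fold2 w) | w in [set w : seq K | nonzeros w /\ weight w = t]].
Proof.
move=> t_gt0.
have comE (h : G) (w : seq K) : a * h = prodAB w -> commutator a h = prodAB (fold2 w).
  by move=> e; rewrite prodAB_fold2 -e /commutator invgM genAV !mulgA -(mulgA _ a a) genA2 mulg1.
apply/seteqP; split=> [g [lg [h /commutator_bb[w [nw w0 e]] eg]]|_ [w [nw wt] <-]].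
  exists w; last by rewrite eg (comE _ _ e).
  split=> //; move: lg; rewrite eg (comE _ _ e) hlength_prodAB // ?reduced_nonzeros ?nonzeros_fold2 //.
  by rewrite weight_fold2 //; lia.
have w0 : w != [::] by apply/eqP => w0; rewrite w0 weight_nil in wt; lia.
split; first by rewrite hlength_prodAB ?reduced_nonzeros ?nonzeros_fold2 // weight_fold2 // wt.
have e : a * (a * prodAB w) = prodAB w by rewrite genAK.
exists (a * prodAB w); last by rewrite (comE _ _ e).
by apply/commutator_bb; exists w.
Qed.

(* The normal form of the commutator [b^m, h]. *)
Definition bfold (w : seq K) : seq K := mid m :: rcons (w ++ mid m :: revopp w) 0%R.

Lemma reduced_bfold w : nonzeros w -> reduced (bfold w).
Proof.
move=> nw; rewrite /bfold /= reduced_tail_rcons nonzeros_cat nw /nonzeros /=.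
by rewrite mid_neq0 //= -/(nonzeros _) nonzeros_revopp.
Qed.

Lemma bfold_inj : injective bfold.
Proof.
move=> w w' [] /eqP; rewrite eqseq_rcons => /andP[/eqP e _].
by apply: (foldk_inj m_gt0); rewrite /foldk; congr (_ ++ _).
Qed.

(** The commutator begins with b^m and ends with a, the latter encoded by the final 0 of [bfold].
    This 0 contributes 1 to the length, which is thus the weight of the cyclic word [foldk w]. *)
Lemma NbbE t : Nbb m t =
  [set ev (bfold w) | w in [set w : seq K | nonzeros w /\ (weight w + m.+1 = t)%N]].
Proof.
have bm : b ^+ m = powB (mid m) by rewrite -powBMn.
have comE (w : seq K) : commutator (b ^+ m) (prodAB w * a) = ev (bfold w).
  rewrite /commutator /bfold /= -cats1 prodAB_cat prodAB1 powB0 mulg1 prodAB_midfold.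
  by rewrite bm powB_midV invgM genAV !mulgA.
have len (w : seq K) : nonzeros w -> hlength (ev (bfold w)) = (2 * (weight w + m.+1))%N.
  move=> nw; rewrite hlengthE // nform_ev ?reduced_bfold //= -cats1 !weight_cat.
  by rewrite !weight_cons weight_revopp // weight_nil nrm_mid // nrm0; lia.
apply/seteqP; split=> [g [lg [h /aa_wordE[w nw e] eg]]|_ [w [nw wt] <-]].
  exists w; last by rewrite eg e comE.
  by split=> //; move: lg; rewrite eg e comE len //; lia.
split; first by rewrite len // wt.
by exists (prodAB w * a); [apply/aa_wordE; exists w|rewrite comE].
Qed.

End ReciprocalSets.

(** * Counting *)

Lemma cardset_image (S : eqType) (T : choiceType) (f : S -> T) (A : set S) (s : seq S) :
  (forall w, A w <-> w \in s) -> cardset [set f w | w in A] = size (undup (map f s)).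
Proof.
move=> As; rewrite /cardset.
have -> : [set f w | w in A] = [set` [fset x in map f s]%fset].
  apply/seteqP; split=> [_ [w /As ws <-]|x] /=; rewrite inE; first exact: map_f.
  by move=> /mapP[w /As Aw ->]; exists w.
by rewrite set_fsetK card_fseq.
Qed.

Lemma count_fibres (S T : eqType) (f : S -> T) (P : pred S) (s : seq S) (cs : seq T) :
  uniq cs -> {in s, forall x, f x \in cs} ->
  count P s = \sum_(c <- cs) count (fun x => P x && (f x == c)) s.
Proof.
move=> ucs fcs; under eq_bigr do rewrite -sum1_count big_mkcond /=.
rewrite exchange_big /= -sum1_count big_mkcond /= big_seq [RHS]big_seq.
apply: eq_bigr => x xs; case: (P x) => /=; last by rewrite big1.
rewrite -big_mkcond sum1_count (eq_count (a2 := pred1 (f x))).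
  by rewrite count_uniq_mem // fcs.
by move=> c /=; rewrite eq_sym.
Qed.

(** By the last hypothesis a fibre of f has at most two elements, whence the first inequality. It
    contains x and rho x, so it has two elements unless x is fixed, and the fixed point then counts
    a second time. *)
Lemma involution_fibres (S T : eqType) (f : S -> T) (rho : S -> S) (s : seq S) :
  uniq s -> {in s, forall x, rho x \in s} -> (forall x, f (rho x) = f x) ->
  {in s & &, forall x y z, f x = f y -> f x = f z -> [\/ x = y, x = z | y = z]} ->
  (size s <= 2 * size (undup (map f s)) <= size s + count (fun x => rho x == x) s)%N.
Proof.
move=> us rs frho fib; set cs := undup _.
have fcs : {in s, forall x, f x \in cs} by move=> x xs; rewrite mem_undup map_f.
have ucs : uniq cs by exact: undup_uniq.
rewrite -(count_predT s) !(count_fibres _ ucs fcs) -big_split /=.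
rewrite -[size cs]sum1_size big_distrr /=; apply/andP.
split; rewrite [leqLHS]big_seq [leqRHS]big_seq; apply: leq_sum => c ccs; rewrite muln1.
  rewrite -size_filter; case E : [seq _ <- _ | _] => [|x [|y [|z r]]] //.
  have : uniq [:: x, y, z & r] by rewrite -E filter_uniq.
  have mem w : w \in [:: x, y, z & r] -> w \in s /\ f w = c.
    by rewrite -E mem_filter => /andP[/eqP].
  have [xs fx] := mem x (mem_head _ _).
  have [|ys fy] := mem y; first by rewrite !inE eqxx orbT.
  have [|zs fz] := mem z; first by rewrite !inE eqxx !orbT.
  have := fib x y z xs ys zs; rewrite fx fy fz => /(_ erefl erefl).
  by case=> ->; rewrite /= !inE eqxx ?orbT ?andbF.
have /mapP[x xs cE] : c \in map f s by rewrite -mem_undup.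
have [rx|nrx] := eqVneq (rho x) x.
  rewrite -[2]/(1 + 1)%N; apply: leq_add; rewrite -has_count; apply/hasP; exists x => //=.
    by rewrite cE.
  by rewrite rx cE !eqxx.
apply: leq_trans (leq_addr _ _); rewrite -size_filter.
have -> : 2 = size [:: x; rho x] by [].
apply: uniq_leq_size; first by rewrite /= inE eq_sym nrx.
move=> y; rewrite !inE mem_filter => /orP[] /eqP->; first by rewrite cE eqxx.
by rewrite frho cE eqxx rs.
Qed.

Section Counting.
Variable m : nat.
Hypothesis m_gt0 : (0 < m)%N.
Local Notation K := 'Z_(2 * m).

(** The argument n is a bound on the recursion depth; every n >= t gives the same lists, each
    consuming at least 1 of t per entry. *)
Fixpoint words_rec (n t : nat) : seq (seq K) :=
  if t is 0 then [:: [::]] else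
  if n is n'.+1 then
    [seq y :: w | y <- [seq y <- enum K | (y != 0%R) && (nrm y < t)%N],
                  w <- words_rec n' (t - (nrm y).+1)]
  else [::].
Definition words (t : nat) : seq (seq K) := words_rec t t.

Lemma mem_words_rec n t w : (t <= n)%N ->
  (w \in words_rec n t) = nonzeros w && (weight w == t).
Proof.
elim: n t w => [|n IHn] [|t] w //= le_t.
- by rewrite inE; case: w => [|y w]; rewrite ?weight_nil ?weight_cons //= andbF.
- by rewrite inE; case: w => [|y w]; rewrite ?weight_nil ?weight_cons //= andbF.
apply/allpairsPdep/andP => [[y [w' [yP w'P ->]]]|[nw /eqP wt]].
  move: yP w'P; rewrite mem_filter mem_enum /= andbT => /andP[ny lty].
  rewrite IHn /=; last by lia.
  by move=> /andP[nw' /eqP e]; rewrite ny nw' weight_cons e; split=> //; apply/eqP; lia.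
case: w nw wt => [|y w] /=; first by rewrite weight_nil.
move=> /andP[ny nw]; rewrite weight_cons => wt; exists y, w; split=> //.
  by rewrite mem_filter mem_enum ny /= andbT; lia.
by rewrite IHn ?nw /=; [apply/eqP|]; lia.
Qed.

Lemma mem_words t w : (w \in words t) = nonzeros w && (weight w == t).
Proof. exact: mem_words_rec. Qed.

Lemma uniq_words_rec n t : uniq (words_rec n t).
Proof.
elim: n t => [|n IHn] [|t] //=; apply: allpairs_uniq_dep => //.
- by rewrite filter_uniq // enum_uniq.
- by move=> [y w] [y' w'] _ _ /= [-> ->].
Qed.

Lemma uniq_words t : uniq (words t).
Proof. exact: uniq_words_rec. Qed.

Lemma size_words_rec n t : (t <= n)%N -> size (words_rec n t) = size (words t).
Proof.
move=> le; apply/perm_size/uniq_perm; rewrite ?uniq_words_rec // => w.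
by rewrite mem_words_rec // mem_words.
Qed.

Lemma size_wordsS t : size (words t.+1) =
  \sum_(y : K | (y != 0%R) && (nrm y <= t)%N) size (words (t - nrm y)).
Proof.
rewrite [LHS]size_allpairs_dep sumnE big_map big_filter big_enum_cond /=.
by apply: eq_bigr => y /andP[_ le]; rewrite subSS size_words_rec // leq_subr.
Qed.

(** The values 1, ..., m - 1 are each taken by a pair y, -y, and m only by [mid]. This is the source
    of the coefficients 2, ..., 2, 1 of the characteristic polynomial. *)
Lemma sum_nrm (F : nat -> nat) :
  \sum_(y : K | y != 0%R) F (nrm y) = 2 * \sum_(1 <= j < m) F j + F m.
Proof.
have -> : \sum_(y : K | y != 0%R) F (nrm y) =
    \sum_(1 <= i < 2 * m) F (minn i (2 * m - i)).
  transitivity (\sum_(0 <= i < (Zp_trunc (2 * m)).+2 | i != 0) F (minn i (2 * m - i))).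
    by rewrite big_mkord.
  rewrite Zp_trunc_2m // big_ltn_cond /=; last by lia.
  rewrite big_nat_cond [RHS]big_nat_cond.
  by apply: eq_bigl => i; case: i => //= i; rewrite andbT.
rewrite (big_cat_nat (n := m)) //=; last by lia.
rewrite [X in _ + X]big_ltn; last by lia.
rewrite (_ : minn m _ = m); last by lia.
have -> : \sum_(m.+1 <= i < 2 * m) F (minn i (2 * m - i)) = \sum_(1 <= j < m) F j.
  rewrite -[m.+1]add1n big_addn (_ : 2 * m - m = m)%N; last by lia.
  rewrite big_nat_rev /=.
  rewrite big_nat [RHS]big_nat; apply: eq_bigr => i ir; congr F; lia.
have -> : \sum_(1 <= i < m) F (minn i (2 * m - i)) = \sum_(1 <= j < m) F j.
  by rewrite big_nat [RHS]big_nat; apply: eq_bigr => i ir; congr F; lia.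
by lia.
Qed.

(* The numbers of words, delayed by m so that the linear recurrence already
   holds from the initial values 0, ..., 0, 1 on. *)
Definition wseq (i : nat) : nat := if (i < m)%N then 0 else size (words (i - m)).

Lemma wseq_init i : (i <= m)%N -> wseq i = (i == m).
Proof.
rewrite leq_eqVlt /wseq => /orP[/eqP->|lt]; first by rewrite ltnn subnn eqxx.
by rewrite lt (ltn_eqF lt).
Qed.

Lemma wseq_rec i :
  wseq (i + m.+1) = 2 * \sum_(1 <= e < m) wseq (i + e) + wseq i.
Proof.
(* F vanishes beyond i just as [wseq] vanishes below m, so that F j is [wseq (i + (m - j))]; the sum
   is then reindexed by e = m - j. *)
pose F j := if (j <= i)%N then size (words (i - j)) else 0.
transitivity (\sum_(y : K | y != 0%R) F (nrm y)).
  rewrite /wseq ifF; last by lia.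
  rewrite (_ : i + m.+1 - m = i.+1)%N; last by lia.
  rewrite size_wordsS big_mkcondr /=; apply: eq_bigr => y _.
  by rewrite /F.
rewrite sum_nrm; congr (2 * _ + _).
  rewrite big_nat_rev /= big_nat [RHS]big_nat; apply: eq_bigr => j jr.
  rewrite /F /wseq; case: (leqP _ i) => le.
    rewrite ltnNge (_ : m <= i + j)%N /=; last by lia.
    by congr (size (words _)); lia.
  by rewrite (_ : i + j < m)%N //; lia.
by rewrite /F /wseq ltnNge; case: leqP.
Qed.

(** * Lists fixed by [revopp] *)

Definition selfdual (t : nat) : nat := count (fun w => revopp w == w) (words t).

(** Cut w in the middle: the second half mirrors the first, and for odd size the central entry is
    nonzero and its own opposite, hence [mid]. *)
Lemma selfdual_split (w : seq K) : nonzeros w -> revopp w = w ->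
  exists p : seq K, w = fold2 p \/ w = p ++ mid m :: revopp p.
Proof.
move=> nw rw; pose h := (size w)./2; exists (take h w).
have sh : size (take h w) = h by rewrite size_takel // /h; lia.
have sw : size w = (odd (size w) + h + h)%N by rewrite -addnA addnn odd_double_half.
have sd : size (drop h w) = (odd (size w) + h)%N by rewrite size_drop {1}sw addnK.
have wE := cat_take_drop h w.
case: (odd (size w)) sd => sd; [right|left].
  case E : (drop h w) sd => [|c d] //= [sd].
  have := rw; rewrite -{1 2}wE E revopp_cat -cat1s revopp_cat -catA => /eqP.
  rewrite eqseq_cat ?size_revopp ?sh ?sd // => /andP[/eqP e1] /= /eqP[e2 e3].
  rewrite -{1}wE E e3; congr (_ ++ _ :: _); apply: oppK_eq => //.
  by move: nw; rewrite -wE E nonzeros_cat => /and3P[].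
have := rw; rewrite -{1 2}wE revopp_cat => /eqP.
rewrite eqseq_cat ?size_revopp ?sh ?sd // => /andP[/eqP e1 /eqP e2].
by rewrite -{1}wE /fold2 e2.
Qed.

(** The half p of a fixed list has weight at most t/2, and the factor 2 accounts for the two shapes
    of [selfdual_split]. *)
Lemma selfdual_le t : (selfdual t <= 2 * \sum_(j < t./2.+1) size (words j))%N.
Proof.
pose l := flatten [seq map (@fold2 m) (words j) ++
                       map (fun p => p ++ mid m :: revopp p) (words j) | j <- iota 0 t./2.+1].
rewrite /selfdual -size_filter; apply: (@leq_trans (size l)).
  apply: uniq_leq_size; first by rewrite filter_uniq // uniq_words.
  move=> w; rewrite mem_filter mem_words => /and3P[/eqP rw nw /eqP wt].
  have [p pw] := selfdual_split nw rw.
  have [np lp] : nonzeros p /\ (weight p <= t./2)%N.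
    case: pw => e; move: nw wt; rewrite e.
      by rewrite nonzeros_fold2 weight_fold2 // => np <-; split=> //; lia.
    rewrite nonzeros_cat weight_cat weight_cons weight_revopp // => /andP[np _] <-.
    by split=> //; lia.
  apply/flattenP; exists (map (@fold2 m) (words (weight p)) ++
     map (fun p => p ++ mid m :: revopp p) (words (weight p))).
    by apply/mapP; exists (weight p) => //; rewrite mem_iota; lia.
  have pin : p \in words (weight p) by rewrite mem_words np eqxx.
  by rewrite mem_cat; case: pw => ->; apply/orP; [left|right]; apply/mapP; exists p.
rewrite size_flatten /shape sumnE !big_map -(big_mkord xpredT (fun j => size (words j))).
rewrite big_distrr /= /index_iota subn0 leq_eqVlt; apply/orP; left; apply/eqP.
by apply: eq_bigr => j _; rewrite size_cat !size_map addnn -mul2n.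
Qed.

(** * Numbers of commutators and of geodesics of a given length *)

Lemma of_length_2 t : (0 < t)%N -> of_length (reciprocal_order2 m) (2 * t) =
  [set class2 w | w in [set w : seq K | nonzeros w /\ weight w = t]].
Proof.
move=> t_gt0; rewrite reciprocal_order2E //; apply/seteqP.
split=> [_ [[w [nw w0] <-]]|_ [w [nw wt] <-]].
  rewrite geod_length_prodAB ?nonzeros_fold2 // weight_fold2 // => e.
  by exists w => //; split=> //; lia.
split; last by rewrite geod_length_prodAB ?nonzeros_fold2 // weight_fold2 // wt.
by exists w => //; split=> //; apply/eqP => w0; rewrite w0 weight_nil in wt; lia.
Qed.

Lemma of_length_k t : of_length (reciprocal_orderk m) (2 * t) =
  [set classk w | w in [set w : seq K | nonzeros w /\ (weight w + m.+1 = t)%N]].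
Proof.
rewrite reciprocal_orderkE //; apply/seteqP.
split=> [_ [[w nw <-]]|_ [w [nw wt] <-]].
  rewrite geod_length_prodAB ?nonzeros_foldk // weight_foldk // => e.
  by exists w => //; split=> //; lia.
split; last by rewrite geod_length_prodAB ?nonzeros_foldk // weight_foldk // wt.
by exists w.
Qed.

(** The test excludes t <= m, where the truncated difference would be 0 and would wrongly yield the
    empty list. *)
Definition kwords (t : nat) : seq (seq K) :=
  if (m < t)%N then words (t - m.+1) else [::].

Lemma mem_kwords t w : (w \in kwords t) = nonzeros w && (weight w + m.+1 == t)%N.
Proof.
rewrite /kwords; case: ltnP => lt; first by rewrite mem_words; congr (_ && _); lia.
by rewrite in_nil; symmetry; apply/negP => /andP[_]; lia.
Qed.

Lemma wordsP t w : (nonzeros w /\ weight w = t) <-> w \in words t.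
Proof. by rewrite mem_words; split=> [[-> ->]|/andP[-> /eqP]]; rewrite ?eqxx. Qed.

Lemma kwordsP t w : (nonzeros w /\ (weight w + m.+1 = t)%N) <-> w \in kwords t.
Proof. by rewrite mem_kwords; split=> [[-> ->]|/andP[-> /eqP]]; rewrite ?eqxx. Qed.

Lemma uniq_kwords t : uniq (kwords t).
Proof. by rewrite /kwords; case: ifP => // _; exact: uniq_words. Qed.

Lemma size_kwords t : (0 < t)%N -> size (kwords t) = wseq t.-1.
Proof.
move=> t_gt0; rewrite /kwords /wseq; case: ltnP => lt.
  by rewrite ltnNge (_ : m <= t.-1)%N /=; [congr (size (words _))|]; lia.
by rewrite (_ : t.-1 < m)%N //; lia.
Qed.

Lemma size_words_wseq t : size (words t) = wseq (t + m).
Proof. by rewrite /wseq ltnNge leq_addl /= addnK. Qed.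

Lemma cardset_Naa t : (0 < t)%N -> cardset (Naa m t) = wseq (t + m).
Proof.
move=> t_gt0; rewrite NaaE // (cardset_image _ (wordsP t)).
rewrite undup_id ?size_map ?size_words_wseq //.
rewrite map_inj_in_uniq ?uniq_words // => w w'.
rewrite !mem_words => /andP[nw _] /andP[nw' _] e; apply: (fold2_inj m_gt0).
by apply: prodAB_inj e; rewrite nonzeros_fold2.
Qed.

Lemma cardset_Nbb t : (0 < t)%N -> cardset (Nbb m t) = wseq t.-1.
Proof.
move=> t_gt0; rewrite NbbE // (cardset_image _ (kwordsP t)).
rewrite undup_id ?size_map ?size_kwords //.
rewrite map_inj_in_uniq ?uniq_kwords // => w w'.
rewrite !mem_kwords => /andP[nw _] /andP[nw' _] /(congr1 (@nform m)).
by rewrite !nform_ev ?reduced_bfold //; exact: (bfold_inj m_gt0).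
Qed.

Lemma mem_words_revopp t w : w \in words t -> revopp w \in words t.
Proof. by rewrite !mem_words nonzeros_revopp weight_revopp. Qed.

Lemma mem_kwords_revopp t w : w \in kwords t -> revopp w \in kwords t.
Proof. by rewrite !mem_kwords nonzeros_revopp weight_revopp. Qed.

Local Notation card2 t := (cardset (of_length (reciprocal_order2 m) (2 * t))).
Local Notation cardk t := (cardset (of_length (reciprocal_orderk m) (2 * t))).

Lemma words_neq0 t w : (0 < t)%N -> w \in words t -> w != [::].
Proof.
by move=> t_gt0; rewrite mem_words; case: w => //; rewrite weight_nil; case: t t_gt0.
Qed.

Lemma card2_bounds t : (0 < t)%N ->
  (wseq (t + m) <= 2 * card2 t <= wseq (t + m) + selfdual t)%N.
Proof.
move=> t_gt0; rewrite of_length_2 // (cardset_image _ (wordsP t)) -size_words_wseq.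
apply: involution_fibres; first exact: uniq_words.
- by move=> w; exact: mem_words_revopp.
- exact: class2_revopp.
move=> w w1 w2 wt w1t w2t; apply: class2_fibre => //; rewrite ?(words_neq0 t_gt0) //.
- by move: wt; rewrite mem_words => /andP[].
- by move: w1t; rewrite mem_words => /andP[].
- by move: w2t; rewrite mem_words => /andP[].
Qed.

Lemma cardk_bounds t : (0 < t)%N ->
  (wseq t.-1 <= 2 * cardk t <= wseq t.-1 + selfdual (t - m.+1))%N.
Proof.
move=> t_gt0; rewrite of_length_k // (cardset_image _ (kwordsP t)) -size_kwords //.
have /andP[lo hi] : (size (kwords t) <= 2 * size (undup (map (@classk m) (kwords t)))
    <= size (kwords t) + count (fun w => revopp w == w) (kwords t))%N.
  apply: involution_fibres; first exact: uniq_kwords.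
  - by move=> w; exact: mem_kwords_revopp.
  - exact: classk_revopp.
  move=> w w1 w2; rewrite !mem_kwords => /andP[n _] /andP[n1 _] /andP[n2 _].
  exact: classk_fibre.
rewrite lo (leq_trans hi) // leq_add2l /kwords; case: ifP => // _.
Qed.

(** The sum counts twice exactly the classes of both types, and by [class2_classk] each of these
    comes from a list fixed by [revopp]. *)
Lemma card_union_bounds t : (0 < t)%N ->
  (cardset (of_length (reciprocal m) (2 * t)) <= card2 t + cardk t
   <= cardset (of_length (reciprocal m) (2 * t)) + selfdual t)%N.
Proof.
move=> t_gt0.
have -> : of_length (reciprocal m) (2 * t) =
    [set id C | C in of_length (reciprocal_order2 m) (2 * t) `|`
              of_length (reciprocal_orderk m) (2 * t)].
  rewrite image_id; apply/seteqP; split=> [C [[r|r] e]|C [[r e]|[r e]]];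
    by [left|right|split=> //; left|split=> //; right].
rewrite of_length_2 // of_length_k //.
set l2 := map (@class2 m) (words t); set lk := map (@classk m) (kwords t).
rewrite (@cardset_image _ _ _ _ (l2 ++ lk)); last first.
  move=> C; rewrite mem_cat; split=> [[]|/orP[]].
  - by move=> [w /wordsP wt <-]; apply/orP; left; exact: map_f.
  - by move=> [w /kwordsP wt <-]; apply/orP; right; exact: map_f.
  - by move=> /mapP[w /wordsP wt ->]; left; exists w.
  - by move=> /mapP[w /kwordsP wt ->]; right; exists w.
rewrite (cardset_image _ (wordsP t)) (cardset_image _ (kwordsP t)) -/l2 -/lk.
rewrite map_id undup_cat size_cat size_filter.
have <- : count (mem lk) (undup l2) + count (fun C => C \notin lk) (undup l2) =
    size (undup l2) by exact: (count_predC (mem lk)).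
have : (count (mem lk) (undup l2) <= selfdual t)%N.
  rewrite -size_filter /selfdual -size_filter.
  rewrite -[X in (_ <= X)%N](size_map (@class2 m)).
  apply: uniq_leq_size; first by rewrite filter_uniq // undup_uniq.
  move=> C; rewrite mem_filter mem_undup => /andP[/mapP[w' w't ->] /mapP[w wt e]].
  rewrite e; apply: map_f; rewrite mem_filter wt andbT; apply/eqP.
  apply: (@class2_classk _ m_gt0 w w') => //.
  - by move: wt; rewrite mem_words => /andP[].
  - by move: w't; rewrite mem_kwords => /andP[].
  - exact: words_neq0 wt.
by move=> le; rewrite -addnA leq_addl /= addnC leq_add2l.
Qed.

End Counting.

Local Open Scope ring_scope.

(** * The characteristic polynomial *)

Section CharPoly.
Variable m : nat.
Hypothesis m_ge2 : (2 <= m)%N.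

Lemma horner_char_poly2m (F : comNzRingType) (x : F) :
  (char_poly2m F m).[x] = x ^+ m.+1 - 2 * \sum_(1 <= i < m) x ^+ i - 1.
Proof.
rewrite /char_poly2m !hornerE horner_sum mulr_sumr; congr (_ - _ - _).
by apply: eq_bigr => i _; rewrite hornerZ hornerXn.
Qed.

Lemma root_char_poly2m (F : comNzRingType) (x : F) :
  root (char_poly2m F m) x = (x ^+ m.+1 == 2 * \sum_(1 <= i < m) x ^+ i + 1).
Proof. by rewrite rootE horner_char_poly2m -addrA -opprD subr_eq0. Qed.

Lemma sum_powers (F : comNzRingType) (x : F) :
  (x - 1) * \sum_(1 <= i < m) x ^+ i = x ^+ m - x.
Proof.
case: m m_ge2 => [|n] // _; elim: n => [|n IHn].
  by rewrite big_geq // mulr0 expr1 subrr.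
by rewrite big_nat_recr //= mulrDr IHn [x ^+ n.+2]exprS; ring.
Qed.

(** Multiplication by X - 1 telescopes the geometric sum; the trinomial so obtained has a derivative
    with easily located zeros. *)
Lemma char_poly2m_factor (F : comNzRingType) :
  ('X - 1) * char_poly2m F m = ('X + 1) * ('X^(m.+1) - 'X^m *+ 2 + 1).
Proof.
rewrite /char_poly2m -scaler_sumr scaler_nat.
transitivity ('X * 'X^(m.+1) - 'X^(m.+1) - (('X - 1) * \sum_(1 <= i < m) 'X^i) *+ 2 - ('X - 1) : {poly F}).
  by ring.
by rewrite sum_powers exprS; ring.
Qed.

Lemma char_poly2m_size_lead (F : comNzRingType) :
  size (char_poly2m F m) = m.+2 /\ char_poly2m F m \is monic.
Proof.
have lt : (size (- (\sum_(1 <= i < m) 2%:R *: 'X^i) - 1 : {poly F})%R < size ('X^(m.+1) : {poly F})%R)%N.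
  rewrite size_polyXn ltnS; apply: leq_trans (size_polyD _ _) _.
  rewrite geq_max !size_polyN size_poly1 /= andbT.
  apply: leq_trans (size_sum _ _ _) _; rewrite big_seq.
  apply/bigmax_leqP_seq => i; rewrite mem_index_iota => ir _.
  by apply: leq_trans (size_scale_leq _ _) _; rewrite size_polyXn; lia.
rewrite /char_poly2m -addrA; split; first by rewrite size_polyDl // size_polyXn.
by rewrite monicE lead_coefDl // lead_coefXn.
Qed.

Lemma root_neq0 (F : comNzRingType) (z : F) : root (char_poly2m F m) z -> z != 0.
Proof.
rewrite root_char_poly2m; apply: contraL => /eqP->.
rewrite expr0n /= big_nat big1 => [|i ir]; last by rewrite expr0n; case: i ir.
by rewrite mulr0 add0r eq_sym oner_eq0.
Qed.

(** A multiple root z, if not -1, would be a multiple root of the trinomial Q. Since z is nonzero,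
    Q'(z) = 0 gives z = 2m/(m+1), and Q(z) = 0 becomes an identity between integers that fails for m
    >= 2. *)
Lemma deriv_char_poly2m_neq0 (F : numFieldType) (z : F) :
  root (char_poly2m F m) z -> (char_poly2m F m)^`().[z] != 0.
Proof.
move=> rz; apply/eqP => dz; have z0 := root_neq0 rz; move/rootP: rz => rz.
have [Q [E Qz dQz]] : exists Q : {poly F},
    [/\ ('X - 1%:P) * char_poly2m F m = ('X + 1%:P) * Q, Q.[z] = z ^+ m.+1 - 2 * z ^+ m + 1
      & Q^`().[z] = z ^+ m.-1 * (m.+1%:R * z - 2 * m%:R)].
  exists ('X^(m.+1) - 'X^m *+ 2 + 1); split; first exact: char_poly2m_factor.
    by rewrite !hornerE mulr_natl.
  have zm : z ^+ m = z * z ^+ m.-1 by rewrite -exprS prednK // ltnW.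
  rewrite derivD derivB derivMn !derivXn derivC !hornerD hornerN !hornerMn.
  rewrite !hornerXn hornerC /= -[_ *+ m.+1]mulr_natr -[_ *+ m]mulr_natr.
  rewrite -[m.+1%:R]natr1 zm.
  by move: (z ^+ m.-1) (m%:R : F) => w k; ring.
have e0 : (z + 1) * Q.[z] = 0.
  have := congr1 (horner^~ z) E; move: (char_poly2m F m) rz => P rz.
  by rewrite !hornerM rz mulr0 hornerD hornerX hornerC => <-.
have e1 : Q.[z] + (z + 1) * Q^`().[z] = 0.
  have := congr1 (fun p : {poly F} => p^`().[z]) E.
  move: (char_poly2m F m) rz dz => P rz dz.
  rewrite !derivM derivB derivD derivX !derivC subr0 addr0 !mul1r.
  by rewrite !(hornerD, hornerM) rz dz mulr0 addr0 hornerX hornerC => <-.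
(* At -1 the derived identity would give Q(-1) = 0, but this value is 4 or -2 according to the
   parity of m. *)
have [z1|z1] := eqVneq z (-1).
  move: e1; rewrite Qz z1 addNr mul0r addr0 exprS -signr_odd.
  case: (odd m); rewrite ?expr1 ?expr0 => /eqP.
    by rewrite (_ : _ + 1 = 4%:R) ?pnatr_eq0 //; ring.
  by rewrite (_ : _ + 1 = - 2%:R) ?oppr_eq0 ?pnatr_eq0 //; ring.
have z1' : z + 1 != 0 by rewrite addr_eq0.
have {}e0 : Q.[z] = 0 by apply/eqP; move/eqP: e0; rewrite mulf_eq0 (negPf z1').
move: e1; rewrite e0 add0r dQz => /eqP.
rewrite !mulf_eq0 (negPf z1') expf_eq0 (negPf z0) andbF /= subr_eq0 => /eqP ez.
have m1 : m.+1%:R != 0 :> F by rewrite pnatr_eq0.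
(* now z = 2m/(m+1), and m would divide a power of m+1 *)
have : (2 * (2 * m) ^ m = m.+1 ^ m.+1)%N.
  apply/eqP; rewrite -(eqr_nat F) natrM !natrX natrM.
  move: e0; rewrite Qz => /(congr1 (fun y => m.+1%:R ^+ m.+1 * y)).
  rewrite mulr0 mulrDr mulrBr mulr1 -exprMn ez exprS [m.+1%:R ^+ m.+1]exprS.
  rewrite (_ : m.+1%:R * _ * (2 * z ^+ m) = 2 * m.+1%:R * (m.+1%:R * z) ^+ m); last first.
    by rewrite exprMn; ring.
  rewrite ez; set A := _ ^+ m; set B := m.+1%:R ^+ m; rewrite -[m.+1%:R]natr1 => e.
  rewrite -subr_eq0 (_ : _ - _ = - (2 * m%:R * A - 2 * (m%:R + 1) * A + (m%:R + 1) * B)).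
    by rewrite e oppr0.
  by ring.
move=> em; have : (m %| m.+1 ^ m.+1)%N.
  by rewrite -em expnMn mulnA dvdn_mull // dvdn_exp // (ltnW m_ge2).
have cop : coprime m (m.+1 ^ m.+1) by rewrite coprimeXr // coprimenS.
by move=> d; move: (Gauss_dvdr 1 cop); rewrite muln1 d dvdn1 => /esym/eqP; lia.
Qed.

(* Euler's formula: compare leading coefficients in the Lagrange interpolation
   of X^i at the roots of the polynomial. *)
Lemma euler_sum (F : fieldType) (rs : seq F) (n i : nat) :
  let P := \prod_(z <- rs) ('X - z%:P) in
  uniq rs -> size rs = n.+1 -> (i <= n)%N ->
  \sum_(z <- rs) z ^+ i / P^`().[z] = (i == n)%:R.
Proof.
move=> P urs srs le_in; pose q z := \prod_(w <- rem z rs) ('X - w%:P).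
have Pq z : z \in rs -> P = ('X - z%:P) * q z by move=> zrs; rewrite /P (big_rem z).
have dP z : z \in rs -> P^`().[z] = (q z).[z].
  move=> zrs; rewrite (Pq _ zrs) derivM hornerD !hornerM derivXsubC hornerXsubC subrr.
  by rewrite mul0r addr0 hornerC mul1r.
have q0 z x : z \in rs -> x \in rs -> x != z -> (q z).[x] = 0.
  move=> zrs xrs nxz; apply/rootP; rewrite root_prod_XsubC.
  by rewrite mem_rem_uniq // inE nxz.
have qn z : z \in rs -> (q z).[z] != 0.
  move=> zrs; rewrite -rootE root_prod_XsubC mem_rem_uniq // inE eqxx //.
have sq z : z \in rs -> size (q z) = n.+1.
  by move=> zrs; rewrite size_prod_XsubC size_rem // srs.
pose L := \sum_(z <- rs) (z ^+ i / P^`().[z]) *: q z - 'X^i.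
(* L has degree at most n and vanishes at the n + 1 distinct points of [rs]. *)
have L0 : L = 0.
  apply: (@roots_geq_poly_eq0 _ _ rs) => //.
    apply/allP => x xrs; apply/rootP; rewrite /L hornerD hornerN hornerXn horner_sum.
    rewrite (bigD1_seq x) //= big_seq_cond big1 => [|z /andP[zrs nzx]].
      by rewrite hornerZ (dP _ xrs) divfK ?qn // addr0 subrr.
    by rewrite hornerZ q0 ?mulr0 // eq_sym.
  rewrite srs; apply: leq_trans (size_polyD _ _) _.
  rewrite geq_max size_polyN size_polyXn ltnS le_in andbT.
  apply: leq_trans (size_sum _ _ _) _; rewrite big_seq.
  apply/bigmax_leqP_seq => z zrs _; apply: leq_trans (size_scale_leq _ _) _.
  by rewrite sq //; move: zrs.
have := congr1 (fun p : {poly F} => p`_n) L0.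
rewrite /= coef0 coefB coefXn coef_sum => /eqP; rewrite subr_eq0 eq_sym [n == i]eq_sym => /eqP->.
rewrite big_seq [RHS]big_seq; apply: eq_bigr => z zrs; rewrite coefZ.
have -> : (q z)`_n = lead_coef (q z) by rewrite lead_coefE sq.
by rewrite (monicP (monic_prod_XsubC _ _ _)) mulr1.
Qed.

(** Both sides satisfy the same recurrence, and [euler_sum] gives the initial values 0, ..., 0,
    1. *)
Lemma wseq_roots (F : fieldType) (rs : seq F) (i : nat) :
  let P := char_poly2m F m in
  P = \prod_(z <- rs) ('X - z%:P) -> uniq rs ->
  (wseq m i)%:R = \sum_(z <- rs) z ^+ i / P^`().[z].
Proof.
move=> P PE urs; have m_gt0 : (0 < m)%N by exact: ltnW.
have srs : size rs = m.+1.
  by apply/eqP; rewrite -eqSS -(size_prod_XsubC rs id) -PE (char_poly2m_size_lead F).1.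
have [n] := ubnP i; elim: n i => // n IHn i; rewrite ltnS => le_in.
have [le_im|lt_mi] := leqP i m.
  by rewrite wseq_init // PE (euler_sum urs srs).
have [j ej] : exists j, i = (j + m.+1)%N by exists (i - m.+1)%N; rewrite subnK.
rewrite ej wseq_rec // natrD natrM natr_sum.
have IHe e : (1 <= e < m)%N ->
    (wseq m (j + e))%:R = \sum_(z <- rs) z ^+ (j + e) / P^`().[z].
  by move=> er; apply: IHn; lia.
under eq_big_nat => e er do rewrite IHe //.
rewrite (IHn j); last by lia.
rewrite exchange_big /= mulr_sumr -big_split /= big_seq [RHS]big_seq.
apply: eq_bigr => z zrs; have : root P z by rewrite PE root_prod_XsubC.
rewrite root_char_poly2m => /eqP ez; rewrite exprD ez -mulr_suml.
under eq_bigr do rewrite exprD.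
by rewrite -mulr_sumr; ring.
Qed.

End CharPoly.

(** * The dominant root *)

Import ComplexField.Normc.

Section PerronRoot.
Variables (R : realType) (m : nat).
Hypothesis m_ge2 : (2 <= m)%N.
Local Notation C := (R[i]).
Local Notation b := (beta R m).

(** Write y = l x with l > 1: the left power is multiplied by l^(m+1), each term on the right by a
    smaller power of l. *)
Lemma growth_above_root (x y : R) : 0 < x < y ->
  x ^+ m.+1 = 2 * \sum_(1 <= i < m) x ^+ i + 1 ->
  2 * \sum_(1 <= i < m) y ^+ i + 1 < y ^+ m.+1.
Proof.
move=> /andP[x0 xy] ex; pose l := y / x.
have yE : y = l * x by rewrite divfK ?gt_eqF.
have l1 : 1 < l by rewrite ltr_pdivlMr // mul1r.
rewrite yE exprMn ex mulrDr mulr1; apply: ler_ltD; last by rewrite exprn_egt1.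
rewrite mulrCA ler_pM2l // mulr_sumr; apply: ler_sum_nat => i ir.
rewrite exprMn ler_wpM2r ?exprn_ge0 ?(ltW x0) // ler_weXn2l ?(ltW l1) //; lia.
Qed.

Lemma beta_exists : exists2 x : R, 0 < x & root (char_poly2m R m) x.
Proof.
have factor x : (x - 1) * (char_poly2m R m).[x] = (x + 1) * (x ^+ m.+1 - 2 * x ^+ m + 1).
  have := congr1 (horner^~ x) (char_poly2m_factor m_ge2 R).
  by rewrite /= !hornerM !hornerE mulr_natl.
(* At 2 the factors X - 1 and X^(m+1) - 2 X^m + 1 are both 1, leaving X + 1. *)
have p2 : (char_poly2m R m).[2] = 3%:R.
  have := factor 2; rewrite exprS subrr add0r mulr1 (_ : 2 - 1 = 1) ?mul1r //; last by ring.
  by move=> ->; ring.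
have p1 : (char_poly2m R m).[1] <= 0.
  rewrite horner_char_poly2m expr1n addrAC subrr add0r oppr_le0.
  by rewrite mulr_ge0 // sumr_ge0 // => i _; rewrite exprn_ge0.
have [||x /andP[x1 _] rx] := @poly_ivt R (char_poly2m R m) 1 2; first by lra.
  by rewrite p1 p2 ler0n.
by exists x => //; apply: lt_le_trans x1.
Qed.

Lemma positive_root_unique (x y : R) : 0 < x -> 0 < y ->
  root (char_poly2m R m) x -> root (char_poly2m R m) y -> x = y.
Proof.
wlog xy : x y / x < y => [H|] x0 y0 rx ry.
  have [xy|yx|//] := ltgtP x y; first exact: H.
  by symmetry; exact: H.
move: rx ry; rewrite !root_char_poly2m => /eqP ex /eqP ey.
have xy' : 0 < x < y by rewrite x0.
by have := growth_above_root xy' ex; rewrite -ey ltxx.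
Qed.

Lemma betaP : 0 < b /\ root (char_poly2m R m) b.
Proof.
have [x x0 rx] := beta_exists.
by apply: (@xgetPex _ 0 [set x : R | 0 < x /\ root (char_poly2m R m) x]); exists x.
Qed.

Lemma beta_eq : b ^+ m.+1 = 2 * \sum_(1 <= i < m) b ^+ i + 1.
Proof. by have [_] := betaP; rewrite root_char_poly2m => /eqP. Qed.

Lemma beta_gt1 : 1 < b.
Proof.
have [b0 _] := betaP; rewrite ltNge; apply/negP => b1.
have : b ^+ m.+1 <= 1 by rewrite exprn_ile1 // ltW.
apply/negP; rewrite -ltNge beta_eq ltrDr mulr_gt0 // big_ltn //.
by rewrite ltr_pwDl ?exprn_gt0 // sumr_ge0 // => i _; rewrite exprn_ge0 // ltW.
Qed.

Lemma le_normcD (x y : C) : normc (x + y) <= normc x + normc y.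
Proof. exact: complex.le_normcD. Qed.

Lemma normc_natmul (x : C) n : normc (x *+ n) = normc x *+ n.
Proof. exact: complex.normcMn. Qed.

Lemma normcX (z : C) n : normc (z ^+ n) = normc z ^+ n.
Proof. by elim: n => [|n IHn]; rewrite ?normc1 // !exprS normcM IHn. Qed.

Lemma normc_ge0 (z : C) : 0 <= normc z.
Proof. by case: z => x y; rewrite sqrtr_ge0. Qed.

Lemma le_normc_sum (T : eqType) (r : seq T) (P : pred T) (F : T -> C) :
  normc (\sum_(i <- r | P i) F i) <= \sum_(i <- r | P i) normc (F i).
Proof.
elim/big_ind2: _ => [|x1 x2 y1 y2 h1 h2|//]; first by rewrite normc0.
by apply: le_trans (le_normcD _ _) _; exact: lerD.
Qed.

Lemma le_Re_normc (z : C) : `|complex.Re z| <= normc z.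
Proof.
by case: z => x y /=; rewrite -sqrtr_sqr ler_wsqrtr // lerDl sqr_ge0.
Qed.

(* In case of equality the triangle inequality for 2z + 1 is an equality,
   which forces z to be a positive real. *)
Lemma normc_root_lt (z : C) : root (char_poly2m C m) z -> z != (b%:C)%C ->
  normc z < b.
Proof.
rewrite root_char_poly2m => /eqP ez nz; set r := normc z.
have r0 : 0 <= r by exact: normc_ge0.
have [b0 _] := betaP.
have ltm : (1 < m)%N by [].
(* The two lowest terms stay together so that the equality case concerns |2z + 1| = 2|z| + 1
   alone. *)
have sumE (F : comNzRingType) (x : F) : 2 * \sum_(1 <= i < m) x ^+ i + 1 =
    2 * \sum_(2 <= i < m) x ^+ i + (2 * x + 1).
  by rewrite big_ltn // expr1; ring.
have le1 : r ^+ m.+1 <= 2 * \sum_(2 <= i < m) r ^+ i + normc (2 * z + 1).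
  rewrite -normcX ez sumE; apply: le_trans (le_normcD _ _) _.
  rewrite lerD2r mulr_natl normc_natmul mulr_natl lerMn2r /=.
  apply: le_trans (le_normc_sum _ _ _) _.
  by apply: ler_sum => i _; rewrite normcX.
have le2 : normc (2 * z + 1) <= 2 * r + 1.
  by apply: le_trans (le_normcD _ _) _; rewrite normc1 !mulr_natl normc_natmul.
rewrite ltNge; apply/negP; rewrite le_eqVlt => /orP[/eqP br|br]; last first.
  have br' : 0 < b < r by rewrite b0.
  have := growth_above_root br' beta_eq.
  by rewrite ltNge sumE (le_trans le1) // lerD2l.
have ge2 : 2 * r + 1 <= normc (2 * z + 1).
  by have := le1; rewrite -br beta_eq sumE lerD2l.
case/eqP: nz; move: ge2 br; rewrite /r; case: (z) => x y.
rewrite (_ : 2 * _ + 1 = Complex (2 * x + 1) (2 * y)); last first.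
  by rewrite mulr_natl mulr2n; apply/eqP; rewrite eq_complex /= ; apply/andP; split; apply/eqP; ring.
rewrite /normc => ge br.
have s0 : 0 <= x ^+ 2 + y ^+ 2 by rewrite addr_ge0 ?sqr_ge0.
have bb : b ^+ 2 = x ^+ 2 + y ^+ 2 by rewrite br sqr_sqrtr.
have s1 : 0 <= (2 * x + 1) ^+ 2 + (2 * y) ^+ 2 by rewrite addr_ge0 ?sqr_ge0.
have bq : (2 * b + 1) ^+ 2 <= (2 * x + 1) ^+ 2 + (2 * y) ^+ 2.
  by rewrite -(sqr_sqrtr s1) ler_sqr ?nnegrE ?sqrtr_ge0 // br //; nra.
(* Expanding [bq] and cancelling 4 b^2 = 4 (x^2 + y^2) leaves 4b <= 4x. *)
have bx : b <= x by nra.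
have y0 : y = 0 by apply/eqP; rewrite -sqrf_eq0; apply/eqP; nra.
have {}bx : x = b.
  by move: bb; rewrite y0 expr0n addr0 => /eqP; rewrite eqrXn2 // ?(ltW b0) // => [/eqP//|]; lra.
by rewrite bx y0.
Qed.

Lemma roots_complex : {rs : seq C | uniq rs &
  char_poly2m C m = \prod_(z <- rs) ('X - z%:P)}.
Proof.
have [rs e] := closed_field_poly_normal (char_poly2m C m).
have [_ mon] := char_poly2m_size_lead m_ge2 C.
rewrite (monicP mon) scale1r in e; exists rs => //.
rewrite -separable_prod_XsubC -e unlock; apply: Pdiv.ClosedField.root_coprimep => x.
exact: deriv_char_poly2m_neq0.
Qed.

Lemma char_poly2m_complex :
  char_poly2m C m = map_poly (real_complex R) (char_poly2m R m).
Proof.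
rewrite /char_poly2m !rmorphB /= rmorph1 map_polyXn rmorph_sum /=.
by congr (_ - _ - _); apply: eq_bigr => i _; rewrite map_polyZ map_polyXn rmorph_nat.
Qed.

Lemma cvg_sum0 (T : eqType) (s : seq T) (f : T -> nat -> R) :
  (forall z, z \in s -> f z @ \oo --> (0 : R)) ->
  (fun t => \sum_(z <- s) f z t) @ \oo --> (0 : R).
Proof.
elim: s => [|z s IHs] fs.
  by under eq_fun do rewrite big_nil; exact: cvg_cst.
under eq_fun do rewrite big_cons.
have fz : f z @ \oo --> (0 : R) by apply: fs; exact: mem_head.
have fr : (fun t => \sum_(x <- s) f x t) @ \oo --> (0 : R).
  by apply: IHs => x xs; apply: fs; rewrite inE xs orbT.
by have := cvgD fz fr; rewrite addr0; apply.
Qed.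

(** After division by b^t every other root contributes a geometric term of ratio less than 1. The
    left side is real, so it can be compared with real parts. *)
Lemma cvg_root_sum (rs : seq C) (c : C -> C) (u : nat -> nat) (t0 : nat) :
  uniq rs -> (forall z, (z \in rs) = root (char_poly2m C m) z) ->
  (forall t, (t0 <= t)%N -> (u t)%:R = \sum_(z <- rs) c z * z ^+ t) ->
  (fun t => (u t)%:R / b ^+ t) @ \oo --> complex.Re (c (b%:C)%C).
Proof.
move=> urs rsP uE; have [b0 rb] := betaP.
have brs : (b%:C)%C \in rs.
  by rewrite rsP char_poly2m_complex rootE horner_map (rootP rb) rmorph0.
set l := complex.Re _.
pose B t := \sum_(z <- rem (b%:C)%C rs) normc (c z) * (normc z / b) ^+ t.
have B0 : B @ \oo --> (0 : R).
  apply: cvg_sum0 => z; rewrite mem_rem_uniq // inE => /andP[nz zrs].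
  apply: (@cvg_geometric R).
  rewrite ger0_norm ?divr_ge0 ?normc_ge0 ?(ltW b0) //.
  by rewrite ltr_pdivrMr // mul1r normc_root_lt // -rsP.
apply: (@squeeze_cvgr _ _ _ _ (fun t => l - B t) (fun t => l + B t)); last 2 first.
- by have := cvgB (cvg_cst l) B0; rewrite subr0; apply.
- by have := cvgD (cvg_cst l) B0; rewrite addr0; apply.
near=> t; rewrite -ler_distl.
have bt : 0 < b ^+ t by rewrite exprn_gt0.
have : (u t)%:R - c (b%:C)%C * ((b ^+ t)%:C)%C =
    \sum_(z <- rem (b%:C)%C rs) c z * z ^+ t.
  rewrite uE; last by near: t; exact: nbhs_infty_ge.
  by rewrite (big_rem _ brs) /= -rmorphXn addrAC subrr add0r.
move=> /(congr1 (@complex.Re R)).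
have -> : complex.Re ((u t)%:R - c (b%:C)%C * ((b ^+ t)%:C)%C) = (u t)%:R - l * b ^+ t.
  rewrite -(rmorph_nat (real_complex R)) /l; case: (c _) => x y /=.
  by rewrite mulr0 subr0.
move=> e; rewrite -[l](mulfK (lt0r_neq0 bt)) -mulrBl e normrM normfV (gtr0_norm bt).
rewrite ler_pdivrMr //; apply: le_trans (le_Re_normc _) _.
apply: le_trans (le_normc_sum _ _ _) _; rewrite /B mulr_suml.
apply: ler_sum => z _; rewrite normcM normcX expr_div_n -mulrA divfK //.
exact: lt0r_neq0.
Unshelve. all: by end_near. Qed.

(** Uniqueness of the coefficient comes from uniqueness of limits: any admissible expansion has it
    as the limit of u t / b^t. *)
Lemma beta_coefE (rs : seq C) (c : C -> C) (u : nat -> nat) (t0 : nat) (d : R) :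
  uniq rs -> (forall z, (z \in rs) = root (char_poly2m C m) z) ->
  (forall t, (t0 <= t)%N -> (u t)%:R = \sum_(z <- rs) c z * z ^+ t) ->
  c (b%:C)%C = (d%:C)%C -> beta_coef R m t0 u = d.
Proof.
move=> urs rsP uE cd; have := cvg_root_sum urs rsP uE; rewrite cd /= => limd.
apply: xget_unique; first by exists rs, c.
move=> y [rs' [c' [urs' rsP' uE' cy]]].
have := cvg_root_sum urs' rsP' uE'; rewrite cy /= => limy.
exact: (cvg_unique (@norm_hausdorff _ _) limy limd).
Qed.

(* Its inverse is the coefficient of beta^i in the expression of wseq. *)
Definition dbeta : R := ((char_poly2m R m)^`()).[b].

Lemma deriv_complex_beta :
  (char_poly2m C m)^`().[(b%:C)%C] = (dbeta%:C)%C.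
Proof. by rewrite char_poly2m_complex deriv_map horner_map. Qed.

Lemma dbeta_neq0 : dbeta != 0.
Proof. by apply: deriv_char_poly2m_neq0 => //; case: betaP. Qed.

Lemma mem_roots (rs : seq C) : char_poly2m C m = \prod_(z <- rs) ('X - z%:P) ->
  forall z, (z \in rs) = root (char_poly2m C m) z.
Proof. by move=> -> z; rewrite root_prod_XsubC. Qed.

Lemma wseq_shift_cvg : (fun t => (wseq m (t + m))%:R / b ^+ t) @ \oo --> b ^+ m / dbeta.
Proof.
have [rs urs e] := roots_complex; have rsP := mem_roots e.
have := @cvg_root_sum rs (fun z => z ^+ m / (char_poly2m C m)^`().[z])
  (fun t => wseq m (t + m)) 0 urs rsP.
rewrite deriv_complex_beta -rmorphXn -fmorphV -rmorphM /=; apply=> t _.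
rewrite (wseq_roots m_ge2 _ e urs); apply: eq_bigr => z _.
by rewrite exprD; ring.
Qed.

(** The factor b^m reflects the delay of [wseq]; for [e_const] the index t - 1 yields b^-1
    instead. *)
Lemma d_constE : d_const R m = b ^+ m / dbeta.
Proof.
have [rs urs e] := roots_complex; have rsP := mem_roots e.
apply: (beta_coefE (c := fun z => z ^+ m / (char_poly2m C m)^`().[z]) urs rsP).
  move=> t t2; rewrite cardset_Naa ?(ltnW m_ge2) ?(leq_trans _ t2) //.
  rewrite (wseq_roots m_ge2 _ e urs); apply: eq_bigr => z _.
  by rewrite exprD; ring.
by rewrite deriv_complex_beta -rmorphXn -fmorphV -rmorphM.
Qed.

Lemma wseq_pred_expand (rs : seq C) t : uniq rs ->
  char_poly2m C m = \prod_(z <- rs) ('X - z%:P) -> (0 < t)%N ->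
  (wseq m t.-1)%:R = \sum_(z <- rs) z^-1 / (char_poly2m C m)^`().[z] * z ^+ t.
Proof.
move=> urs e t0; rewrite (wseq_roots m_ge2 _ e urs) big_seq [RHS]big_seq.
apply: eq_bigr => z; rewrite (mem_roots e) => /root_neq0 z0.
by rewrite -{2}(prednK t0) exprS mulrAC mulKf ?z0.
Qed.

Lemma wseq_pred_cvg : (fun t => (wseq m t.-1)%:R / b ^+ t) @ \oo --> b^-1 / dbeta.
Proof.
have [rs urs e] := roots_complex; have rsP := mem_roots e.
have := @cvg_root_sum rs (fun z => z^-1 / (char_poly2m C m)^`().[z])
  (fun t => wseq m t.-1) 1 urs rsP.
rewrite deriv_complex_beta -!fmorphV -rmorphM /=; apply=> t t0.
exact: wseq_pred_expand.
Qed.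

Lemma e_constE : e_const R m = b^-1 / dbeta.
Proof.
have [rs urs e] := roots_complex; have rsP := mem_roots e.
apply: (beta_coefE (c := fun z => z^-1 / (char_poly2m C m)^`().[z]) urs rsP).
  move=> t t3; have t0 : (0 < t)%N by exact: leq_trans t3.
  by rewrite cardset_Nbb ?(ltnW m_ge2) // (wseq_pred_expand urs e).
by rewrite deriv_complex_beta -!fmorphV -rmorphM.
Qed.

(** It is nonzero because the root is simple, and nonnegative as a limit of nonnegative
    quotients. *)
Lemma d_const_gt0 : 0 < d_const R m.
Proof.
have [b0 _] := betaP; rewrite lt_neqAle d_constE; apply/andP; split.
  by rewrite eq_sym mulf_neq0 ?invr_neq0 ?dbeta_neq0 // expf_neq0 // lt0r_neq0.
apply: (cvgr_to_ge wseq_shift_cvg).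
by near=> t; rewrite divr_ge0 // exprn_ge0 // ltW.
Unshelve. all: by end_near. Qed.

Lemma e_const_gt0 : 0 < e_const R m.
Proof.
have [b0 _] := betaP; have := d_const_gt0; rewrite d_constE e_constE.
by rewrite !pmulr_rgt0 ?exprn_gt0 ?invr_gt0.
Qed.

End PerronRoot.

(** * Asymptotics *)

Section Asymptotics.
Variables (R : realType) (m : nat).
Hypothesis m_ge2 : (2 <= m)%N.
Local Notation b := (beta R m).
Local Notation card2 t := (cardset (of_length (reciprocal_order2 m) (2 * t))).
Local Notation cardk t := (cardset (of_length (reciprocal_orderk m) (2 * t))).
Local Notation cardr t := (cardset (of_length (reciprocal m) (2 * t))).

Lemma beta_gt0 : 0 < b. Proof. by case: (betaP R m_ge2). Qed.

(** The powers of b satisfy the same recurrence and dominate the initial values since b > 1. *)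
Lemma wseq_le i : (wseq m i)%:R <= b ^+ i.
Proof.
have b1 := beta_gt1 R m_ge2; have m0 := ltnW m_ge2.
have [n] := ubnP i; elim: n i => // n IHn i; rewrite ltnS => le_in.
have [le_im|lt_mi] := leqP i m.
  rewrite wseq_init //; apply: le_trans (_ : 1 <= _); last by rewrite exprn_ege1 // ltW.
  by rewrite lern1 leq_b1.
have [j ej] : exists j, i = (j + m.+1)%N by exists (i - m.+1)%N; rewrite subnK.
rewrite ej wseq_rec // exprD beta_eq // mulrDr mulr1 natrD natrM natr_sum.
apply: lerD; last by apply: IHn; lia.
rewrite mulrCA ler_pM2l // mulr_sumr; apply: ler_sum_nat => e er.
by rewrite -exprD; apply: IHn; lia.
Qed.

Lemma selfdual_bound : exists2 K : R, 0 <= K &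
  forall t, (selfdual m t)%:R <= K * Num.sqrt b ^+ t.
Proof.
have b0 := beta_gt0; have b1 := beta_gt1 R m_ge2; have m0 := ltnW m_ge2.
have s2 : Num.sqrt b ^+ 2 = b by rewrite sqr_sqrtr // ltW.
have s1 : 1 <= Num.sqrt b by rewrite -[1]sqrtr1 ler_wsqrtr // ltW.
have bm1 : 0 < b - 1 by rewrite subr_gt0.
(* The 2 comes from [selfdual_le], b^m from the delay of [wseq], and b / (b - 1) from summing the
   geometric series up to t/2. *)
exists (2 * b ^+ m.+1 / (b - 1)).
  by rewrite divr_ge0 ?(ltW bm1) // mulr_ge0 // exprn_ge0 // ltW.
move=> t; apply: le_trans (_ : (2 * \sum_(j < t./2.+1) b ^+ (j + m)) <= _).
  apply: le_trans (_ : (2 * \sum_(j < t./2.+1) size (words m j))%:R <= _).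
    by rewrite ler_nat selfdual_le.
  rewrite natrM natr_sum ler_pM2l //; apply: ler_sum => j _.
  by rewrite size_words_wseq; exact: wseq_le.
have sumE : (b - 1) * \sum_(j < t./2.+1) b ^+ j = b ^+ t./2.+1 - 1 by rewrite -subrX1.
rewrite mulrAC ler_pdivlMr // [leRHS]mulrAC -mulrA -mulrA ler_pM2l //.
under eq_bigr do rewrite exprD.
rewrite -mulr_suml mulrAC [_ * (b - 1)]mulrC sumE exprS.
have le_t : b ^+ t./2 <= Num.sqrt b ^+ t.
  rewrite -{1}s2 -exprM ler_weXn2l //; lia.
apply: le_trans (_ : b * b ^+ t./2 * b ^+ m <= _).
  by rewrite ler_wpM2r ?exprn_ge0 ?(ltW b0) // gerBl.
rewrite [b ^+ m.+1]exprS mulrAC [leRHS]mulrC.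
by rewrite ler_wpM2l // mulr_ge0 ?exprn_ge0 // ltW.
Qed.

Lemma selfdual_cvg0 (f : nat -> nat) : (forall t, (f t <= t)%N) ->
  (fun t => (selfdual m (f t))%:R / b ^+ t) @ \oo --> (0 : R).
Proof.
move=> ft; have [K K0 le_sd] := selfdual_bound.
have b0 := beta_gt0; have b1 := beta_gt1 R m_ge2.
have s2 : Num.sqrt b ^+ 2 = b by rewrite sqr_sqrtr // ltW.
have s0 : 0 < Num.sqrt b by rewrite sqrtr_gt0.
have s1 : 1 < Num.sqrt b by rewrite -[1]sqrtr1 ltr_sqrt.
have lim : geometric K (Num.sqrt b)^-1 @ \oo --> (0 : R).
  apply: cvg_geometric; rewrite ger0_norm ?invr_ge0 ?(ltW s0) //.
  by rewrite invf_lt1.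
apply: (squeeze_cvgr _ (cvg_cst 0) lim); apply: nearW => t.
have bt : 0 < b ^+ t by rewrite exprn_gt0.
rewrite divr_ge0 ?(ltW bt) //= ler_pdivrMr //; apply: le_trans (le_sd _) _.
have bE : b ^+ t = Num.sqrt b ^+ t * Num.sqrt b ^+ t.
  by rewrite -expr2 -exprM mulnC exprM s2.
have sn : Num.sqrt b ^+ t != 0 by rewrite lt0r_neq0 // exprn_gt0.
by rewrite /= -mulrA ler_wpM2l // exprVn bE mulKf // ler_weXn2l // ltW.
Qed.

(** The function f allows for the shifted argument t - m - 1 in the case of order k. *)
Lemma half_cvg (n : nat -> nat) (u f : nat -> nat) (l : R) :
  (forall t, (f t <= t)%N) ->
  (forall t, (0 < t)%N -> (u t <= 2 * n t <= u t + selfdual m (f t))%N) ->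
  (fun t => (u t)%:R / b ^+ t) @ \oo --> l ->
  (fun t => (n t)%:R / b ^+ t) @ \oo --> l / 2.
Proof.
move=> ft bnd lim; have b0 := beta_gt0.
have lo : (fun t => (u t)%:R / b ^+ t / 2) @ \oo --> l / 2.
  by apply: cvgM lim _; exact: cvg_cst.
have hi : (fun t => (u t)%:R / b ^+ t / 2 + (selfdual m (f t))%:R / b ^+ t / 2) @ \oo --> l / 2.
  have := cvgD lo (cvgM (selfdual_cvg0 ft) (cvg_cst (2^-1 : R))).
  by rewrite mul0r addr0; apply.
apply: (squeeze_cvgr _ lo hi); near=> t.
have t0 : (0 < t)%N by near: t; exact: nbhs_infty_gt.
have bt : 0 < (b ^+ t)^-1 by rewrite invr_gt0 exprn_gt0.
have /andP[] := bnd t t0; rewrite -!(ler_nat R) natrD natrM => h1 h2.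
rewrite -mulrDl -mulrDl ![_ / 2]mulrAC !ler_pM2r //.
by rewrite ler_pdivrMr // ler_pdivlMr // ![_ * 2]mulrC h1.
Unshelve. all: by end_near. Qed.

Lemma card2_cvg : (fun t => (card2 t)%:R / b ^+ t) @ \oo --> d_const R m / 2.
Proof.
apply: (half_cvg (u := fun t => wseq m (t + m)) (f := id)) => //.
  by move=> t t0; apply: card2_bounds => //; exact: ltnW.
by rewrite d_constE //; exact: wseq_shift_cvg.
Qed.

Lemma cardk_cvg : (fun t => (cardk t)%:R / b ^+ t) @ \oo --> e_const R m / 2.
Proof.
apply: (half_cvg (u := fun t => wseq m t.-1) (f := fun t => (t - m.+1)%N)).
- by move=> t; exact: leq_subr.
- by move=> t t0; apply: cardk_bounds => //; exact: ltnW.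
by rewrite e_constE //; exact: wseq_pred_cvg.
Qed.

Lemma cardr_cvg :
  (fun t => (cardr t)%:R / b ^+ t) @ \oo --> (d_const R m + e_const R m) / 2.
Proof.
have hi : (fun t => (card2 t)%:R / b ^+ t + (cardk t)%:R / b ^+ t) @ \oo -->
    (d_const R m + e_const R m) / 2.
  by rewrite mulrDl; exact: cvgD card2_cvg cardk_cvg.
have lo : (fun t => (card2 t)%:R / b ^+ t + (cardk t)%:R / b ^+ t
    - (selfdual m t)%:R / b ^+ t) @ \oo --> (d_const R m + e_const R m) / 2.
  by have := cvgB hi (selfdual_cvg0 (f := id) (fun=> leqnn _)); rewrite subr0; apply.
apply: (squeeze_cvgr _ lo hi); near=> t.
have t0 : (0 < t)%N by near: t; exact: nbhs_infty_gt.
have bt : 0 < (b ^+ t)^-1 by rewrite invr_gt0 exprn_gt0 // beta_gt0.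
have /andP[] := card_union_bounds (ltnW m_ge2) t0.
rewrite -!(ler_nat R) !natrD => h1 h2.
rewrite -mulrDl -mulrBl !ler_pM2r // h1 andbT.
by rewrite lerBlDr.
Unshelve. all: by end_near. Qed.

Lemma card_ratio_cvg :
  (fun t => (cardk t)%:R / (card2 t)%:R : R) @ \oo --> e_const R m / d_const R m.
Proof.
have d0 := d_const_gt0 R m_ge2; have b0 := beta_gt0.
have d2 : d_const R m / 2 != 0 by rewrite lt0r_neq0 // divr_gt0.
have lim : (fun t => ((cardk t)%:R / b ^+ t) / ((card2 t)%:R / b ^+ t)) @ \oo -->
    (e_const R m / 2) / (d_const R m / 2).
  by apply: cvgM cardk_cvg _; exact: cvgV d2 card2_cvg.
(* For y = 0 both sides are 0, inversion of 0 giving 0. *)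
have cancel (x y z : R) : z != 0 -> (x / z) / (y / z) = x / y.
  by move=> z0; rewrite invf_div mulrA divfK.
rewrite cancel // in lim; apply: cvg_trans lim; apply: near_eq_cvg; near=> t.
by rewrite cancel // lt0r_neq0 // exprn_gt0.
Unshelve. all: by end_near. Qed.

End Asymptotics.

Theorem corollaryC (R : realType) (m : nat) (hm : (2 <= m)%N) :
  [/\ (fun t : nat =>
         (cardset (of_length (reciprocal_orderk m) (2 * t)))%:R
         / (cardset (of_length (reciprocal_order2 m) (2 * t)))%:R : R)
        @ \oo --> e_const R m / d_const R m,
      (fun t : nat =>
         (cardset (of_length (reciprocal m) (2 * t)))%:R / beta R m ^+ t : R)
        @ \oo --> (d_const R m + e_const R m) / 2,
      [/\ 0 < beta R m, root (char_poly2m R m) (beta R m)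
        & forall x : R, 0 < x -> root (char_poly2m R m) x -> x = beta R m],
      0 < d_const R m
    & 0 < e_const R m].
Proof.
have [b0 rb] := betaP R hm; split.
- exact: card_ratio_cvg.
- exact: cardr_cvg.
- by split=> // x x0 rx; exact: (positive_root_unique hm).
- exact: d_const_gt0.
- exact: e_const_gt0.
Qed.
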